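(* Let $\mathbb{F}$ be a field of characteristic 0. Every multilinear polynomial identity of degree 7 satisfied by the pre-Lie triple products $[a,b,c]_1=(a\cdot b)\cdot c$ and $[a,b,c]_2=a\cdot(b\cdot c)$, where $a\cdot b=a\prec b-b\succ a$, in every dendriform dialgebra over $\mathbb{F}$ follows from the identities of lower degree. That is, $\ker\mathcal{E}_7\subseteq\mathrm{TT}_7$ equals the $S_7$-submodule of $\mathrm{TT}_7$ generated by all liftings to degree 7 of elements of $\ker\mathcal{E}_5$.
   Context: A dendriform dialgebra over $\mathbb{F}$ is a vector space with two bilinear operations $\prec,\succ$ satisfying, for all $x,y,z$: $(x\succ y)\prec z = x\succ(y\prec z)$; $(x\prec y)\prec z = x\prec(y\prec z)+x\prec(y\succ z)$; $x\succ(y\succ z)=(x\succ y)\succ z+(x\prec y)\succ z$. $\mathrm{DD}_n$ denotes the multilinear subspace of degree $n$ of the free dendriform dialgebra on $x_1,\dots,x_n$ over $\mathbb{F}$. $\mathrm{TT}_n$ ($n$ odd) denotes the multilinear subspace of degree $n$ of the free (nonassociative) algebra on $x_1,\dots,x_n$ with two trilinear operations $[x,y,z]_1,[x,y,z]_2$ and no relations. $S_n$ acts on both by permuting the variables, $\sigma\cdot x_i=x_{\sigma(i)}$. The expansion map $\mathcal{E}_n\colon\mathrm{TT}_n\to\mathrm{DD}_n$ is the linear map that replaces each occurrence of $[x,y,z]_1$ by $(x\cdot y)\cdot z$ and each occurrence of $[x,y,z]_2$ by $x\cdot(y\cdot z)$, where $x\cdot y=x\prec y-y\succ x$. The multilinear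 identities of degree $n$ satisfied by the pre-Lie triple products are the elements of $\ker\mathcal{E}_n$. Liftings: for $f=f(x_1,\dots,x_n)\in\mathrm{TT}_n$, its $2(n+3)$ liftings to $\mathrm{TT}_{n+2}$ are, for $i=1,2$: the $n$ substitutions $f(x_1,\dots,[x_k,x_{n+1},x_{n+2}]_i,\dots,x_n)$ for $k=1,\dots,n$, and the three products $[f,x_{n+1},x_{n+2}]_i$, $[x_{n+1},f,x_{n+2}]_i$, $[x_{n+1},x_{n+2},f]_i$. The liftings generate the $S_{n+2}$-module of consequences of $f$ in degree $n+2$. (Liftings to degree 5 of degree 3 identities already lie in $\ker\mathcal{E}_5$.) *)

(* Defs.v *)
From HB Require Import structures.
From mathcomp Require Import all_boot all_order all_algebra perm.
From mathcomp Require Import generic_quotient ring_quotient finmap boolp.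
From mathcomp Require Import monalg.

Set Implicit Arguments.
Unset Strict Implicit.
Unset Printing Implicit Defensive.

Import GRing.Theory.

Local Open Scope ring_scope.
Local Open Scope quotient_scope.

Section LinearExtension.
Context (F : fieldType) (K : choiceType).

Definition linext (V : lmodType F) (g : K -> V) (f : {malg F[K]}) : V :=
  \sum_(k <- msupp f) f@_k *: g k.

Context (V : lmodType F).
Implicit Types (g : K -> V) (f : {malg F[K]}).

Lemma linextEw g f (d : {fset K}) : (msupp f `<=` d)%fset ->
  linext g f = \sum_(k <- d) f@_k *: g k.
Proof.
move=> le; rewrite /linext; apply/big_fset_incl => // k _ /mcoeff_outdom ->.
by rewrite scale0r.
Qed.

Fact linext_is_linear g : linear (linext g).
Proof.
move=> c f1 f2; pose d := (msupp f1 `|` msupp f2)%fset.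
have s1 : (msupp f1 `<=` d)%fset by apply: fsubsetUl.
have s2 : (msupp f2 `<=` d)%fset by apply: fsubsetUr.
have s12 : (msupp (c *: f1 + f2) `<=` d)%fset.
  apply: fsubset_trans (msuppD_le _ _) _; rewrite fsubUset s2 andbT.
  exact: fsubset_trans (msuppZ_le _ _) s1.
rewrite (linextEw _ s1) (linextEw _ s2) (linextEw _ s12) scaler_sumr -big_split.
by apply: eq_bigr => k _; rewrite mcoeffD mcoeffZ scalerDl scalerA.
Qed.

HB.instance Definition _ g :=
  GRing.isLinear.Build F {malg F[K]} V *:%R (linext g) (linext_is_linear g).

Lemma linextU g k : linext g << k >> = g k.
Proof. by rewrite (linextEw _ msuppU_le) big_seq_fset1 mcoeffUU scale1r. Qed.

Lemma linear_linext (W : lmodType F) (h : V -> W) g f :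
  linear h -> h (linext g f) = linext (fun k => h (g k)) f.
Proof.
move=> hl; pose H : {linear V -> W} := HB.pack h (GRing.isLinear.Build F V W *:%R h hl).
rewrite -[h]/(H : V -> W) linear_sum; apply: eq_bigr => k _.
by rewrite linearZ.
Qed.

Lemma linext_basis f : linext (fun k => << k >> : {malg F[K]}) f = f.
Proof.
rewrite [RHS]monalgE; apply: eq_bigr => k _; apply/malgP => k'.
by rewrite mcoeffZ !mcoeffU mulrnAr mulr1.
Qed.

End LinearExtension.

HB.mixin Record Lmodule_isDendriform (F : fieldType) V of GRing.Lmodule F V := {
  dprec : V -> V -> V;
  dsucc : V -> V -> V;
  dprec_linl : forall y, linear (fun x => dprec x y);
  dprec_linr : forall x, linear (dprec x);
  dsucc_linl : forall y, linear (fun x => dsucc x y);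
  dsucc_linr : forall x, linear (dsucc x);
  dsuccprecA : forall x y z, dprec (dsucc x y) z = dsucc x (dprec y z);
  dprecA : forall x y z,
    dprec (dprec x y) z = dprec x (dprec y z) + dprec x (dsucc y z);
  dsuccA : forall x y z,
    dsucc x (dsucc y z) = dsucc (dsucc x y) z + dsucc (dprec x y) z
}.

#[short(type="dendType")]
HB.structure Definition Dendriform (F : fieldType) :=
  {V of Lmodule_isDendriform F V & GRing.Lmodule F V}.

Section DendriformMonomials.

(* Monomials of the free algebra on X with two binary operations. *)
Inductive dmon (X : Type) : Type :=
  | DVar of X
  | DPrec of dmon X & dmon X
  | DSucc of dmon X & dmon X.

Fixpoint dmon_enc (X : Type) (m : dmon X) : GenTree.tree X :=
  match m with
  | DVar x => GenTree.Leaf x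
  | DPrec a b => GenTree.Node 0 [:: dmon_enc a; dmon_enc b]
  | DSucc a b => GenTree.Node 1 [:: dmon_enc a; dmon_enc b]
  end.

Fixpoint dmon_dec (X : Type) (t : GenTree.tree X) : option (dmon X) :=
  match t with
  | GenTree.Leaf x => Some (DVar x)
  | GenTree.Node b [:: s; t] =>
      if (dmon_dec s, dmon_dec t) is (Some a, Some c) then
        Some (if b is 0%N then DPrec a c else DSucc a c)
      else None
  | _ => None
  end.

Lemma dmon_encK X : pcancel (@dmon_enc X) (@dmon_dec X).
Proof. by elim=> [x|a /= -> b ->|a /= -> b ->]. Qed.

HB.instance Definition _ (X : choiceType) :=
  Choice.copy (dmon X) (pcan_type (@dmon_encK X)).

End DendriformMonomials.

HB.lock Definition mprec (F : fieldType) (X : choiceType) (f g : {malg F[dmon X]}) :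
  {malg F[dmon X]} := linext (fun a => linext (fun b => << DPrec a b >>) g) f.
HB.lock Definition msucc (F : fieldType) (X : choiceType) (f g : {malg F[dmon X]}) :
  {malg F[dmon X]} := linext (fun a => linext (fun b => << DSucc a b >>) g) f.

Section FreeDendriform.
Context (F : fieldType) (X : choiceType).
Local Notation M := {malg F[dmon X]}.
Local Notation mprec := (@mprec F X).
Local Notation msucc := (@msucc F X).

Fact mprec_linl g : linear (mprec^~ g).
Proof. by move=> c f1 f2; rewrite mprec.unlock linearP. Qed.
Fact mprec_linr f : linear (mprec f).
Proof.
move=> c g1 g2; rewrite mprec.unlock /linext scaler_sumr -big_split /=.
apply: eq_bigr => a _; rewrite -!/(linext _ _) linearP scalerDr !scalerA.
by rewrite mulrC.
Qed.
Fact msucc_linl g : linear (msucc^~ g).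
Proof. by move=> c f1 f2; rewrite msucc.unlock linearP. Qed.
Fact msucc_linr f : linear (msucc f).
Proof.
move=> c g1 g2; rewrite msucc.unlock /linext scaler_sumr -big_split /=.
apply: eq_bigr => a _; rewrite -!/(linext _ _) linearP scalerDr !scalerA.
by rewrite mulrC.
Qed.

Inductive dend_ideal : M -> Prop :=
  | DI_rel1 x y z :
      dend_ideal (mprec (msucc x y) z - msucc x (mprec y z))
  | DI_rel2 x y z :
      dend_ideal (mprec (mprec x y) z - (mprec x (mprec y z) + mprec x (msucc y z)))
  | DI_rel3 x y z :
      dend_ideal (msucc x (msucc y z) - (msucc (msucc x y) z + msucc (mprec x y) z))
  | DI_zero : dend_ideal 0
  | DI_add f g : dend_ideal f -> dend_ideal g -> dend_ideal (f + g)
  | DI_scale c f : dend_ideal f -> dend_ideal (c *: f)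
  | DI_precl f g : dend_ideal f -> dend_ideal (mprec f g)
  | DI_precr f g : dend_ideal g -> dend_ideal (mprec f g)
  | DI_succl f g : dend_ideal f -> dend_ideal (msucc f g)
  | DI_succr f g : dend_ideal g -> dend_ideal (msucc f g).

Definition dideal : {pred M} := fun f => `[< dend_ideal f >].

Fact dideal_zmod_closed : zmod_closed dideal.
Proof.
split=> [|f g /asboolP If /asboolP Ig]; apply/asboolP; first exact: DI_zero.
by apply: DI_add => //; rewrite -scaleN1r; apply: DI_scale.
Qed.
HB.instance Definition _ := GRing.isZmodClosed.Build M dideal dideal_zmod_closed.

(* The free dendriform dialgebra on X: the free algebra with two binary
   operations modulo the ideal generated by the dendriform relations. *)
Definition freeDend : Type := Quotient.quot dideal.
HB.instance Definition _ := GRing.Zmodule.on freeDend.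

End FreeDendriform.

HB.lock Definition dproj (F : fieldType) (X : choiceType) (f : {malg F[dmon X]}) :
  freeDend F X := \pi_(Quotient.quot (@dideal F X)) f.

Section FreeDendriformTheory.
Context (F : fieldType) (X : choiceType).
Local Notation M := {malg F[dmon X]}.
Local Notation dproj := (@dproj F X).

Lemma dprojP f g : dproj f = dproj g <-> dend_ideal (f - g).
Proof.
split=> [/eqP|I]; first by rewrite dproj.unlock -Quotient.idealrBE => /asboolP.
by apply/eqP; rewrite dproj.unlock -Quotient.idealrBE; apply/asboolP.
Qed.

Lemma dprojD f g : dproj (f + g) = dproj f + dproj g.
Proof. by rewrite dproj.unlock raddfD. Qed.

Lemma dproj_repr q : dproj (repr q) = q.
Proof. by rewrite dproj.unlock; exact: reprK. Qed.

Lemma repr_dproj f : dend_ideal (repr (dproj f) - f).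
Proof. by apply/dprojP; rewrite dproj_repr. Qed.

End FreeDendriformTheory.

HB.lock Definition fd_scale (F : fieldType) (X : choiceType) (c : F)
  (q : freeDend F X) : freeDend F X := dproj (c *: repr q).
HB.lock Definition fd_prec (F : fieldType) (X : choiceType)
  (p q : freeDend F X) : freeDend F X := dproj (mprec (repr p) (repr q)).
HB.lock Definition fd_succ (F : fieldType) (X : choiceType)
  (p q : freeDend F X) : freeDend F X := dproj (msucc (repr p) (repr q)).

Section FreeDendriformStructure.
Context (F : fieldType) (X : choiceType).
Local Notation M := {malg F[dmon X]}.
Local Notation dproj := (@dproj F X).
Local Notation fd_scale := (@fd_scale F X).
Local Notation fd_prec := (@fd_prec F X).
Local Notation fd_succ := (@fd_succ F X).

Lemma dproj_scale c f : fd_scale c (dproj f) = dproj (c *: f).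
Proof. by rewrite fd_scale.unlock; apply/dprojP; rewrite -scalerBr; apply/DI_scale/repr_dproj. Qed.

Let bilinB (m : M -> M -> M) (ml : forall g, linear (m^~ g))
    (mr : forall f, linear (m f)) f g f' g' :
  m f g - m f' g' = m (f - f') g + m f' (g - g').
Proof.
have -> : f - f' = (-1) *: f' + f by rewrite scaleN1r addrC.
have -> : g - g' = (-1) *: g' + g by rewrite scaleN1r addrC.
by rewrite ml mr !scaleN1r [- m f' g + _]addrC -addrA [- m f' g + _]addrCA addNr addr0.
Qed.

Lemma dproj_prec f g : fd_prec (dproj f) (dproj g) = dproj (mprec f g).
Proof.
rewrite fd_prec.unlock; apply/dprojP; rewrite (bilinB (@mprec_linl F X) (@mprec_linr F X)); apply: DI_add.
  by apply: DI_precl; apply: repr_dproj.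
by apply: DI_precr; apply: repr_dproj.
Qed.

Lemma dproj_succ f g : fd_succ (dproj f) (dproj g) = dproj (msucc f g).
Proof.
rewrite fd_succ.unlock; apply/dprojP; rewrite (bilinB (@msucc_linl F X) (@msucc_linr F X)); apply: DI_add.
  by apply: DI_succl; apply: repr_dproj.
by apply: DI_succr; apply: repr_dproj.
Qed.

Lemma fd_scaleA a b q : fd_scale a (fd_scale b q) = fd_scale (a * b) q.
Proof. by rewrite -[q]dproj_repr !dproj_scale scalerA. Qed.
Lemma fd_scale1 : left_id 1 fd_scale.
Proof. by move=> q; rewrite -[q]dproj_repr !dproj_scale scale1r. Qed.
Lemma fd_scaleDr : right_distributive fd_scale +%R.
Proof.
move=> c p q; rewrite -[p]dproj_repr -[q]dproj_repr.
by rewrite -dprojD !dproj_scale scalerDr dprojD.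
Qed.
Lemma fd_scaleDl q : {morph fd_scale^~ q : a b / a + b}.
Proof. by move=> a b; rewrite -[q]dproj_repr !dproj_scale scalerDl dprojD. Qed.

HB.instance Definition _ := GRing.Zmodule_isLmodule.Build F (freeDend F X)
  fd_scaleA fd_scale1 fd_scaleDr fd_scaleDl.

Fact dproj_is_linear : linear dproj.
Proof. by move=> c f g; rewrite dprojD -dproj_scale. Qed.
HB.instance Definition _ :=
  GRing.isLinear.Build F M (freeDend F X) *:%R dproj dproj_is_linear.

Fact fd_prec_linl q : linear (fun p => fd_prec p q).
Proof.
move=> c p p'; rewrite -[q]dproj_repr -[p]dproj_repr -[p']dproj_repr.
by rewrite -dproj_is_linear !dproj_prec mprec_linl dproj_is_linear.
Qed.
Fact fd_prec_linr p : linear (fd_prec p).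
Proof.
move=> c q q'; rewrite -[p]dproj_repr -[q]dproj_repr -[q']dproj_repr.
by rewrite -dproj_is_linear !dproj_prec mprec_linr dproj_is_linear.
Qed.
Fact fd_succ_linl q : linear (fun p => fd_succ p q).
Proof.
move=> c p p'; rewrite -[q]dproj_repr -[p]dproj_repr -[p']dproj_repr.
by rewrite -dproj_is_linear !dproj_succ msucc_linl dproj_is_linear.
Qed.
Fact fd_succ_linr p : linear (fd_succ p).
Proof.
move=> c q q'; rewrite -[p]dproj_repr -[q]dproj_repr -[q']dproj_repr.
by rewrite -dproj_is_linear !dproj_succ msucc_linr dproj_is_linear.
Qed.

Fact fd_succprecA x y z : fd_prec (fd_succ x y) z = fd_succ x (fd_prec y z).
Proof.
rewrite -[x]dproj_repr -[y]dproj_repr -[z]dproj_repr.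
by rewrite !(dproj_prec, dproj_succ); apply/dprojP/DI_rel1.
Qed.
Fact fd_precA x y z :
  fd_prec (fd_prec x y) z = fd_prec x (fd_prec y z) + fd_prec x (fd_succ y z).
Proof.
rewrite -[x]dproj_repr -[y]dproj_repr -[z]dproj_repr.
by rewrite !(dproj_prec, dproj_succ) -dprojD; apply/dprojP/DI_rel2.
Qed.
Fact fd_succA x y z :
  fd_succ x (fd_succ y z) = fd_succ (fd_succ x y) z + fd_succ (fd_prec x y) z.
Proof.
rewrite -[x]dproj_repr -[y]dproj_repr -[z]dproj_repr.
by rewrite !(dproj_prec, dproj_succ) -dprojD; apply/dprojP/DI_rel3.
Qed.

HB.instance Definition _ := Lmodule_isDendriform.Build F (freeDend F X)
  fd_prec_linl fd_prec_linr fd_succ_linl fd_succ_linr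
  fd_succprecA fd_precA fd_succA.

Definition fdvar (x : X) : freeDend F X := dproj << DVar x >>.

End FreeDendriformStructure.

Definition dend_hom (F : fieldType) (D E : dendType F) (h : D -> E) : Prop :=
  [/\ linear h, {morph h : x y / dprec x y} & {morph h : x y / dsucc x y}].

Section Universal.
Context (F : fieldType) (X : choiceType) (D : dendType F) (v : X -> D).
Local Notation M := {malg F[dmon X]}.

Fixpoint deval (m : dmon X) : D :=
  match m with
  | DVar x => v x
  | DPrec a b => dprec (deval a) (deval b)
  | DSucc a b => dsucc (deval a) (deval b)
  end.

Let L : M -> D := linext deval.

Let linext2 (op : dmon X -> dmon X -> dmon X) (m : D -> D -> D)
    (ml : forall y, linear (fun x => m x y)) (mr : forall x, linear (m x)) f g :
  (forall a b, deval (op a b) = m (deval a) (deval b)) ->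
  L (linext (fun a => linext (fun b => << op a b >> : M) g) f) = m (L f) (L g).
Proof.
move=> mE; rewrite /L linear_linext; last exact: linext_is_linear.
rewrite (linear_linext _ _ (ml _)); apply: eq_bigr => a _; congr (_ *: _).
rewrite linear_linext; last exact: linext_is_linear.
rewrite (linear_linext _ _ (mr _)); apply: eq_bigr => b _; congr (_ *: _).
by rewrite linextU mE.
Qed.

Let Lprec f g : L (mprec f g) = dprec (L f) (L g).
Proof. rewrite mprec.unlock; exact: (linext2 dprec_linl dprec_linr). Qed.
Let Lsucc f g : L (msucc f g) = dsucc (L f) (L g).
Proof. rewrite msucc.unlock; exact: (linext2 dsucc_linl dsucc_linr). Qed.

Let lin0 (h : D -> D) : linear h -> h 0 = 0.
Proof. by move=> hl; rewrite -[X in h X](subrr 0) addrC -scaleN1r hl scaleN1r addNr. Qed.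

Let LD f g : L (f + g) = L f + L g. Proof. exact: linearD. Qed.
Let LZ c f : L (c *: f) = c *: L f. Proof. exact: linearZ. Qed.
Let LB f g : L (f - g) = L f - L g. Proof. exact: linearB. Qed.

Let L_ideal f : dend_ideal f -> L f = 0.
Proof.
elim=> {f}.
- by move=> x y z; rewrite LB !(Lprec, Lsucc) dsuccprecA subrr.
- by move=> x y z; rewrite LB LD !(Lprec, Lsucc) dprecA subrr.
- by move=> x y z; rewrite LB LD !(Lprec, Lsucc) dsuccA subrr.
- exact: linear0.
- by move=> f g _ If _ Ig; rewrite LD If Ig addr0.
- by move=> c f _ If; rewrite LZ If scaler0.
- by move=> f g _ If; rewrite Lprec If (lin0 (dprec_linl _)).
- by move=> f g _ Ig; rewrite Lprec Ig (lin0 (dprec_linr _)).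
- by move=> f g _ If; rewrite Lsucc If (lin0 (dsucc_linl _)).
- by move=> f g _ Ig; rewrite Lsucc Ig (lin0 (dsucc_linr _)).
Qed.

Definition fdeval (q : freeDend F X) : D := linext deval (repr q).

Lemma fdeval_dproj f : fdeval (dproj f) = linext deval f.
Proof. by apply/eqP; rewrite -subr_eq0 -[X in X == 0]LB L_ideal //; apply: repr_dproj. Qed.

Theorem freeDend_universal :
  [/\ dend_hom fdeval, forall x, fdeval (fdvar F x) = v x
    & forall h : freeDend F X -> D,
        dend_hom h -> (forall x, h (fdvar F x) = v x) -> h =1 fdeval].
Proof.
split=> [|x|h [hl hp hs] hv q].
- split=> [c p q|p q|p q]; rewrite -[p]dproj_repr -[q]dproj_repr.
  + by rewrite -dproj_is_linear !fdeval_dproj linext_is_linear.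
  + by rewrite [dprec _ _]dproj_prec !fdeval_dproj [LHS]Lprec.
  + by rewrite [dsucc _ _]dproj_succ !fdeval_dproj [LHS]Lsucc.
- by rewrite fdeval_dproj linextU.
rewrite -[q]dproj_repr fdeval_dproj -[X in h (dproj X)]linext_basis.
rewrite linear_linext; last exact: dproj_is_linear.
rewrite linear_linext //; apply: eq_bigr => m _; congr (_ *: _).
elim: m => [x|a IHa b IHb|a IHa b IHb]; first exact: hv.
- rewrite /= -IHa -IHb -hp; congr h.
  by rewrite [RHS]dproj_prec mprec.unlock !linextU.
- rewrite /= -IHa -IHb -hs; congr h.
  by rewrite [RHS]dproj_succ msucc.unlock !linextU.
Qed.

End Universal.

(* Monomials of the free algebra with two trilinear operations; TOp false is
   [_, _, _]_1 and TOp true is [_, _, _]_2. *)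
Inductive tmon (X : Type) : Type :=
  | TVar of X
  | TOp of bool & tmon X & tmon X & tmon X.

Section FreeTriple.

Fixpoint tmon_enc (X : Type) (m : tmon X) : GenTree.tree X :=
  match m with
  | TVar x => GenTree.Leaf x
  | TOp i a b c => GenTree.Node i [:: tmon_enc a; tmon_enc b; tmon_enc c]
  end.

Fixpoint tmon_dec (X : Type) (t : GenTree.tree X) : option (tmon X) :=
  match t with
  | GenTree.Leaf x => Some (TVar x)
  | GenTree.Node i [:: r; s; t] =>
      if (tmon_dec r, tmon_dec s, tmon_dec t) is (Some a, Some b, Some c) then
        Some (TOp (i == 1%N) a b c)
      else None
  | _ => None
  end.

Lemma tmon_encK X : pcancel (@tmon_enc X) (@tmon_dec X).
Proof. by elim=> [x|[] a /= -> b -> c ->]. Qed.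

HB.instance Definition _ (X : choiceType) :=
  Choice.copy (tmon X) (pcan_type (@tmon_encK X)).

Fixpoint tvars (X : Type) (m : tmon X) : seq X :=
  match m with
  | TVar x => [:: x]
  | TOp _ a b c => tvars a ++ tvars b ++ tvars c
  end.

Fixpoint tmon_eval (X V : Type) (op : bool -> V -> V -> V -> V) (v : X -> V)
    (m : tmon X) : V :=
  match m with
  | TVar x => v x
  | TOp i a b c =>
      op i (tmon_eval op v a) (tmon_eval op v b) (tmon_eval op v c)
  end.

End FreeTriple.

Notation freeTriple F X := {malg F[tmon X]}.

Section Triple.
Context (F : fieldType) (X : choiceType).

Definition tvar (x : X) : freeTriple F X := << TVar x >>.

Definition tprod (i : bool) (f g h : freeTriple F X) : freeTriple F X :=
  linext (fun a => linext (fun b => linext (fun c =>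
    << TOp i a b c >> : freeTriple F X) h) g) f.

(* Evaluation of f in a space V with two trilinear operations. *)
Definition teval (V : lmodType F) (op : bool -> V -> V -> V -> V) (v : X -> V)
    (f : freeTriple F X) : V :=
  linext (tmon_eval op v) f.

End Triple.

Definition tsubst (F : fieldType) (X Y : choiceType) (s : X -> freeTriple F Y)
    (f : freeTriple F X) : freeTriple F Y :=
  teval (@tprod F Y) s f.

Section PreLie.
Context (F : fieldType) (D : dendType F).

Definition prelie (x y : D) : D := dprec x y - dsucc y x.

Definition prelie_triple (i : bool) (x y z : D) : D :=
  if i then prelie x (prelie y z) else prelie (prelie x y) z.

End PreLie.

Definition expansion (F : fieldType) (X : choiceType) :
    freeTriple F X -> freeDend F X :=
  teval (@prelie_triple F (freeDend F X)) (@fdvar F X).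

Lemma expansion_eq0 (F : fieldType) (X : choiceType) (f : freeTriple F X) :
  expansion f = 0 <->
  forall (D : dendType F) (v : X -> D), teval (@prelie_triple F D) v f = 0.
Proof.
split=> [Ef D v|Ef]; last exact: Ef.
have [[hl hp hs] hv _] := freeDend_universal v.
have hB p q : fdeval v (p - q) = fdeval v p - fdeval v q.
  by rewrite -scaleN1r addrC hl scaleN1r addrC.
have h0 : fdeval v 0 = 0 by rewrite -[X in fdeval v X](subrr 0) hB subrr.
have hP x y : fdeval v (prelie x y) = prelie (fdeval v x) (fdeval v y).
  by rewrite /prelie hB hp hs.
rewrite -h0 -Ef /expansion /teval linear_linext //.
apply: eq_bigr => m _; congr (_ *: _).
elim: m => [x|[] a IHa b IHb c IHc] /=; first by rewrite hv.
- by rewrite /prelie_triple !hP IHa IHb IHc.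
- by rewrite /prelie_triple !hP IHa IHb IHc.
Qed.

(* The variables x_1, ..., x_n are indexed by 'I_n, hence shifted by one. *)
Section Multilinear.
Context (F : fieldType).

Definition TT (n : nat) : {pred freeTriple F 'I_n} :=
  fun f => all (fun m => perm_eq (tvars m) (enum 'I_n)) (msupp f).

Definition kerE (n : nat) (f : freeTriple F 'I_n) : Prop :=
  f \in @TT n /\ expansion f = 0.

Definition permute_vars (n : nat) (s : 'S_n) : freeTriple F 'I_n -> freeTriple F 'I_n :=
  tsubst (fun i => tvar F (s i)).

Section Liftings.
Context (n : nat) (f : freeTriple F 'I_n).

Local Notation x := (fun i : 'I_n => tvar F (lshift 2 i)).
Local Notation y := (tvar F (rshift n (ord0 : 'I_2))).
Local Notation z := (tvar F (rshift n (ord_max : 'I_2))).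

Inductive lifting : freeTriple F 'I_(n + 2) -> Prop :=
  | Lift_subst (i : bool) (k : 'I_n) :
      lifting (tsubst (fun j => if j == k then tprod i (tvar F (lshift 2 k)) y z
                          else tvar F (lshift 2 j)) f)
  | Lift_prod1 (i : bool) : lifting (tprod i (tsubst x f) y z)
  | Lift_prod2 (i : bool) : lifting (tprod i y (tsubst x f) z)
  | Lift_prod3 (i : bool) : lifting (tprod i y z (tsubst x f)).

End Liftings.

Inductive Sn_span (n : nat) (G : freeTriple F 'I_n -> Prop) :
    freeTriple F 'I_n -> Prop :=
  | Span_gen f : G f -> Sn_span G f
  | Span_zero : Sn_span G 0
  | Span_add f g : Sn_span G f -> Sn_span G g -> Sn_span G (f + g)
  | Span_scale c f : Sn_span G f -> Sn_span G (c *: f)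
  | Span_perm s f : Sn_span G f -> Sn_span G (permute_vars s f).

End Multilinear.

(* Main.v *)
Require Import Defs.
From HB Require Import structures.
From mathcomp Require Import all_boot all_order all_algebra perm.
From mathcomp Require Import finmap ring.
From mathcomp Require Import monalg.

(** The product x . y of a dendriform dialgebra is right pre-Lie.

    First, a multilinear element of the free magma that vanishes in every
    dendriform dialgebra lies in the ideal generated by the pre-Lie relation.
    Modulo that ideal every monomial is a combination of the monomials
    ((x u1) u2) .. uk, with u1, .., uk again of this form and increasingly
    ordered by their leftmost letters; these correspond to rooted trees.  The
    coefficient of a rooted tree in the pre-Lie value of a monomial factors
    through a dendriform dialgebra of matrix-valued functions of a discrete
    time, and these coefficients are triangular on the monomials above with
    respect to inclusion of the ancestor relations.

    Second, a triple algebra V satisfying the identities of degree 3 and 5 of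
    the pre-Lie triple products is the odd part of a Z/2-graded pre-Lie algebra
    V + V (x) V / R.  Its product is determined by a b = a (x) b,
    (a b) c = [a,b,c]_1, a (b c) = [a,b,c]_2 and
    (a b) X = (a X) b + a (b X) - a (X b) for X even, and R is spanned by the
    pre-Lie relations of the triples (a b, y, z).  All the conditions to be
    checked reduce to identities of degree at most 5 in V.  Taking for V the
    quotient of the free triple algebra by the consequences of these identities,
    an element of the kernel of the expansion map vanishes in V. *)

Set Implicit Arguments.
Unset Strict Implicit.
Unset Printing Implicit Defensive.

Import GRing.Theory.
Local Open Scope ring_scope.

(* Locked, so that unification never unfolds the finitely supported functions
   underlying [malg]. *)
HB.lock Definition mon (F : fieldType) (K : choiceType) (k : K) :
  {malg F[K]} := << k >>.
Arguments mon F {K} k.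

(** * Linear extension from monomials, and supports *)

Section LinearExtensionTheory.
Context (F : fieldType).

Lemma eq_in_linext (K : choiceType) (V : lmodType F) (g h : K -> V) f :
  (forall k, k \in msupp f -> g k = h k) -> linext g f = linext h f.
Proof. by move=> e; apply: eq_big_seq => k /e ->. Qed.

Lemma linext_comp (K K' : choiceType) (V : lmodType F) (g : K' -> V)
    (h : K -> {malg F[K']}) f :
  linext g (linext h f) = linext (fun k => linext g (h k)) f.
Proof. by apply: linear_linext; apply: linext_is_linear. Qed.

Lemma linext0 (K : choiceType) (V : lmodType F) (g : K -> V) : linext g 0 = 0.
Proof. exact: linear0. Qed.

Lemma linextD (K : choiceType) (V : lmodType F) (g : K -> V) f1 f2 :
  linext g (f1 + f2) = linext g f1 + linext g f2.
Proof. exact: linearD. Qed.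

Lemma linextB (K : choiceType) (V : lmodType F) (g : K -> V) f1 f2 :
  linext g (f1 - f2) = linext g f1 - linext g f2.
Proof. exact: linearB. Qed.

Lemma linextZ (K : choiceType) (V : lmodType F) (g : K -> V) c f :
  linext g (c *: f) = c *: linext g f.
Proof. exact: linearZ. Qed.

Lemma linext_mon (K : choiceType) (V : lmodType F) (g : K -> V) k :
  linext g (mon F k) = g k.
Proof. by rewrite mon.unlock linextU. Qed.

Lemma linext_mon_id (K : choiceType) (f : {malg F[K]}) :
  linext (fun k => mon F k) f = f.
Proof. by rewrite mon.unlock; apply: linext_basis. Qed.

Lemma msupp_mon (K : choiceType) (k k' : K) : (k' \in msupp (mon F k)) = (k' == k).
Proof. by rewrite mon.unlock msuppU oner_eq0 inE. Qed.

Lemma linB (V W : lmodType F) (h : V -> W) : linear h -> {morph h : u v / u - v}.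
Proof. by move=> hl u v; rewrite addrC -scaleN1r hl scaleN1r addrC. Qed.

Definition subspace (V : lmodType F) (P : V -> Prop) :=
  [/\ P 0, forall u v, P u -> P v -> P (u + v) & forall c u, P u -> P (c *: u)].

Lemma subspaceB (V : lmodType F) (P : V -> Prop) u v :
  subspace P -> P u -> P v -> P (u - v).
Proof. by case=> _ PD PZ Pu Pv; apply: PD => //; rewrite -scaleN1r; apply: PZ. Qed.

Lemma subspace_linext (K : choiceType) (V : lmodType F) (P : V -> Prop)
    (g : K -> V) f :
  subspace P -> (forall k, k \in msupp f -> P (g k)) -> P (linext g f).
Proof.
move=> [P0 PD PZ] Pg; rewrite /linext big_seq.
by apply: (big_ind P) => // k /Pg Pk; apply: PZ.
Qed.

Lemma supported_mon (K : choiceType) (Q : pred K) k :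
  Q k -> {in msupp (mon F k), forall k', Q k'}.
Proof. by move=> Qk k'; rewrite msupp_mon => /eqP ->. Qed.

Lemma supported_subspace (K : choiceType) (Q : pred K) :
  subspace (fun f : {malg F[K]} => {in msupp f, forall k, Q k}).
Proof.
split=> [k|f g sf sg k|c f sf k]; first by rewrite msupp0 inE.
  by move=> /(fsubsetP (msuppD_le _ _)); rewrite in_fsetU => /orP[/sf|/sg].
by move=> /(fsubsetP (msuppZ_le _ _)) /sf.
Qed.

Lemma supported_linext (K K' : choiceType) (Q : pred K')
    (g : K -> {malg F[K']}) f :
  (forall k, k \in msupp f -> {in msupp (g k), forall k', Q k'}) ->
  {in msupp (linext g f), forall k', Q k'}.
Proof.
by move=> sg; apply: (subspace_linext (P := fun u => {in msupp u, forall k', Q k'})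
  (supported_subspace Q)).
Qed.

End LinearExtensionTheory.

(** * Monomials of the free magma *)

Section BinaryMonomials.

Inductive bmon (X : Type) : Type := BVar of X | BMul of bmon X & bmon X.

Fixpoint bmon_enc (X : Type) (m : bmon X) : GenTree.tree X :=
  match m with
  | BVar x => GenTree.Leaf x
  | BMul a b => GenTree.Node 0 [:: bmon_enc a; bmon_enc b]
  end.

Fixpoint bmon_dec (X : Type) (t : GenTree.tree X) : option (bmon X) :=
  match t with
  | GenTree.Leaf x => Some (BVar x)
  | GenTree.Node _ [:: s; t] =>
      if (bmon_dec s, bmon_dec t) is (Some a, Some c) then Some (BMul a c)
      else None
  | _ => None
  end.

Lemma bmon_encK X : pcancel (@bmon_enc X) (@bmon_dec X).
Proof. by elim=> [x|a /= -> b ->]. Qed.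

HB.instance Definition _ (X : choiceType) :=
  Choice.copy (bmon X) (pcan_type (@bmon_encK X)).

Fixpoint bvars (X : Type) (m : bmon X) : seq X :=
  if m is BMul a b then bvars a ++ bvars b else if m is BVar x then [:: x] else [::].

Fixpoint bhead (X : Type) (m : bmon X) : X :=
  match m with BVar x => x | BMul a _ => bhead a end.

Fixpoint beval (X V : Type) (mul : V -> V -> V) (v : X -> V) (m : bmon X) : V :=
  match m with
  | BVar x => v x
  | BMul a b => mul (beval mul v a) (beval mul v b)
  end.

Lemma bhead_vars (X : eqType) (m : bmon X) : bhead m \in bvars m.
Proof. by elim: m => [x|a IH b _] /=; rewrite ?mem_head ?mem_cat ?IH. Qed.

Lemma size_bvars (X : Type) (m : bmon X) : (0 < size (bvars m))%N.
Proof. by elim: m => //= a IHa b _; rewrite size_cat ltn_addr. Qed.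

End BinaryMonomials.

(** * The ideal generated by the right pre-Lie relation *)

Section PreLieIdeal.
Context (F : fieldType) (X : choiceType).
Local Notation M := {malg F[bmon X]}.
Implicit Types (f g : M) (m a b c : bmon X).

Definition bmulr m f : M := linext (fun a => mon F (BMul a m)) f.
Definition bmull m f : M := linext (fun a => mon F (BMul m a)) f.

(** Right symmetry of the associator: (a, b, c) - (a, c, b). *)
Definition brel a b c : M :=
  mon F (BMul (BMul a b) c) - mon F (BMul a (BMul b c))
  - (mon F (BMul (BMul a c) b) - mon F (BMul a (BMul c b))).

(** By linearity, closure under multiplication by monomials makes this a two-sided ideal. *)
Inductive prelie_ideal : M -> Prop :=
  | PI_rel a b c : prelie_ideal (brel a b c)
  | PI_zero : prelie_ideal 0
  | PI_add f g : prelie_ideal f -> prelie_ideal g -> prelie_ideal (f + g)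
  | PI_scale (c : F) f : prelie_ideal f -> prelie_ideal (c *: f)
  | PI_mulr m f : prelie_ideal f -> prelie_ideal (bmulr m f)
  | PI_mull m f : prelie_ideal f -> prelie_ideal (bmull m f).

Section Evaluation.
Context (V : lmodType F) (mul : V -> V -> V) (v : X -> V) (P : V -> Prop).
Hypothesis mul_linl : forall y, linear (mul^~ y).
Hypothesis mul_linr : forall x, linear (mul x).
Hypothesis subP : subspace P.
Let ev := beval mul v.
Hypothesis Pmulr : forall u m, P u -> P (mul u (ev m)).
Hypothesis Pmull : forall u m, P u -> P (mul (ev m) u).
Hypothesis Prel : forall a b c, P (mul (mul (ev a) (ev b)) (ev c)
  - mul (ev a) (mul (ev b) (ev c)) - (mul (mul (ev a) (ev c)) (ev b)
  - mul (ev a) (mul (ev c) (ev b)))).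

(** A predicate [P] stands for the subspace to be factored out, so that no quotient is formed. It
    will be the zero subspace of a dendriform dialgebra, and later [graded_ideal]. *)
Lemma beval_prelie_ideal f : prelie_ideal f -> P (linext ev f).
Proof.
have [P0 PD PZ] := subP; elim=> {f}.
- by move=> a b c; rewrite /brel !linextB !linext_mon; apply: Prel.
- by rewrite linext0.
- by move=> f g _ Pf _ Pg; rewrite linextD; apply: PD.
- by move=> c f _ Pf; rewrite linextZ; apply: PZ.
- move=> m f _ Pf; rewrite linext_comp.
  under [linext _ f]eq_bigr do rewrite linext_mon /=.
  by have := Pmulr m Pf; rewrite (linear_linext _ _ (mul_linl _)).
- move=> m f _ Pf; rewrite linext_comp.
  under [linext _ f]eq_bigr do rewrite linext_mon /=.
  by have := Pmull m Pf; rewrite (linear_linext _ _ (mul_linr _)).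
Qed.

End Evaluation.
End PreLieIdeal.

(** * Normal forms modulo the pre-Lie relation *)

Section NormalForms.
Context (F : fieldType) (n : nat).
Local Notation X := 'I_n.
Local Notation M := {malg F[bmon X]}.
Implicit Types (f g : M) (m a b c u w : bmon X) (rs us : seq (bmon X)) (A : seq X).

Definition reduces_to (Q : pred (bmon X)) f :=
  exists2 g, {in msupp g, forall m, Q m} & prelie_ideal (f - g).

Lemma reduces_to_mon (Q : pred (bmon X)) m : Q m -> reduces_to Q (mon F m).
Proof.
move=> Qm; exists (mon F m); last by rewrite subrr; apply: PI_zero.
exact: supported_mon.
Qed.

Lemma reduces_to_ideal Q f : prelie_ideal f -> reduces_to Q f.
Proof. by move=> If; exists 0; rewrite ?subr0 // => m; rewrite msupp0 inE. Qed.

Lemma reduces_to_subspace Q : subspace (reduces_to Q).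
Proof.
have [_ sD sZ] := supported_subspace F Q.
split; first exact: reduces_to_ideal (PI_zero _ _).
  move=> f1 f2 [g1 s1 I1] [g2 s2 I2]; exists (g1 + g2); first exact: sD.
  by rewrite opprD addrACA; apply: PI_add.
move=> c f [g s If]; exists (c *: g); first exact: sZ.
by rewrite -scalerBr; apply: PI_scale.
Qed.

Lemma reduces_toD Q f g : reduces_to Q f -> reduces_to Q g -> reduces_to Q (f + g).
Proof. by case: (reduces_to_subspace Q) => _ + _; apply. Qed.

Lemma reduces_to_linext (Q Q' : pred (bmon X)) (h : bmon X -> M) f :
  (forall f', prelie_ideal f' -> prelie_ideal (linext h f')) ->
  (forall m, Q m -> reduces_to Q' (h m)) -> reduces_to Q f ->
  reduces_to Q' (linext h f).
Proof.
move=> hI hQ [g sg If]; rewrite -[f](subrK g) linextD; apply: reduces_toD.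
  by apply/reduces_to_ideal/hI.
by apply: (subspace_linext (reduces_to_subspace _)) => m /sg /hQ.
Qed.

Lemma reduces_to_trans (Q Q' : pred (bmon X)) f :
  (forall m, Q m -> reduces_to Q' (mon F m)) -> reduces_to Q f -> reduces_to Q' f.
Proof.
move=> hQ Qf; rewrite -[f]linext_mon_id.
by apply: reduces_to_linext Qf => // f' If; rewrite linext_mon_id.
Qed.

Lemma reduces_to_bmulr (Q Q' : pred (bmon X)) w f : (forall m, Q m -> Q' (BMul m w)) ->
  reduces_to Q f -> reduces_to Q' (bmulr w f).
Proof.
move=> hQ; apply: reduces_to_linext => [f' If|m /hQ Qm]; first exact: PI_mulr.
exact: reduces_to_mon.
Qed.

(* The left spine of a monomial, last factor first:
   [rspine x [:: uk; ..; u1] = ((x u1) ..) uk]. *)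
Fixpoint rspine (x : X) rs : bmon X :=
  if rs is u :: rs' then BMul (rspine x rs') u else BVar x.

Fixpoint bchildren m : seq (bmon X) :=
  if m is BMul a b then b :: bchildren a else [::].

Lemma rspineK m : rspine (bhead m) (bchildren m) = m.
Proof. by elim: m => //= a -> b. Qed.

Lemma bchildren_rspine x rs : bchildren (rspine x rs) = rs.
Proof. by elim: rs => //= u rs ->. Qed.

Lemma bvars_rspine x rs :
  perm_eq (bvars (rspine x rs)) (x :: flatten (map (@bvars X) rs)).
Proof.
elim: rs => //= u rs IH; rewrite (perm_trans (perm_cat IH (perm_refl _))) //=.
by rewrite perm_cons perm_catC.
Qed.

(** Comparing the last two branches is enough, since the left factor is itself normal. On
    multilinear monomials the order of the branches is strict. *)
Fixpoint normal m : bool :=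
  if m is BMul a b then
    [&& normal a, normal b & if a is BMul _ b' then bhead b' <= bhead b else true]%N
  else true.

Local Notation geh := (fun u w => bhead w <= bhead u)%N.

Lemma normal_rspine x rs :
  normal (rspine x rs) = all normal rs && sorted geh rs.
Proof.
elim: rs => //= u [|w rs] /= IH; first by rewrite !andbT.
by rewrite {}IH /=; case: (normal u); case: (normal w); case: (all normal rs);
  case: (bhead w <= bhead u)%N; case: (path _ w rs).
Qed.

Fixpoint binsert w rs :=
  if rs is b :: rs' then
    if (bhead b <= bhead w)%N then w :: rs else b :: binsert w rs'
  else [:: w].

Fixpoint bsort rs := if rs is u :: rs' then binsert u (bsort rs') else [::].

Lemma perm_binsert w rs : perm_eq (binsert w rs) (w :: rs).
Proof.
elim: rs => //= b rs IH; case: ifP => // _.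
by rewrite (perm_trans (y := b :: w :: rs)) ?perm_cons // (perm_catCA [:: b] [:: w]).
Qed.

Lemma perm_bsort rs : perm_eq (bsort rs) rs.
Proof.
by elim: rs => //= u rs IH; rewrite (perm_trans (perm_binsert _ _)) ?perm_cons.
Qed.

Lemma bsort_sorted rs : sorted geh (bsort rs).
Proof.
elim: rs => //= w rs; elim: (bsort rs) => //= b rs' IH srt.
case: ifP => [/= ->|/negbT] //; rewrite -ltnNge => /ltnW lt_wb.
move: srt IH => /=; case: rs' => [|c rs'] /=; first by rewrite lt_wb.
by move=> /andP[cb pc] /(_ pc); case: ifP => /= _ ->; rewrite ?lt_wb ?cb.
Qed.

(** The error terms of sorting: exchanging two neighbouring branches by [brel] produces monomials in
    which they are merged into one branch. *)
Definition low k A m := (size (bchildren m) < k)%N && perm_eq (bvars m) A.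

(** Modulo [brel], (r b) w is (r w) b plus r (b w) - r (w b), and the last two terms have one branch
    less. What remains is the insertion of [w] into the shorter spine, multiplied by [b] on the
    right. *)
Lemma binsert_low x w rs A : perm_eq (bvars (rspine x (w :: rs))) A ->
  reduces_to (low (size rs).+1 A)
    (mon F (rspine x (w :: rs)) - mon F (rspine x (binsert w rs))).
Proof.
elim: rs A => [|b rs IH] A pA /=.
  by rewrite subrr; apply/reduces_to_ideal/PI_zero.
case: ifP => _; first by rewrite subrr; apply/reduces_to_ideal/PI_zero.
have pA' c : perm_eq (bvars b ++ bvars w) (bvars c) ->
    perm_eq (bvars (BMul (rspine x rs) c)) A.
  move=> pc; rewrite /= -(permPr pA) /= -catA perm_cat2l.
  by rewrite -(permPl pc).
rewrite -[X in X - _](subrK (mon F (BMul (BMul (rspine x rs) w) b))) -addrA.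
apply: reduces_toD.
  have -> : mon F (BMul (BMul (rspine x rs) b) w) - mon F (BMul (BMul (rspine x rs) w) b) =
      brel F (rspine x rs) b w + (mon F (BMul (rspine x rs) (BMul b w))
        - mon F (BMul (rspine x rs) (BMul w b))).
    by apply/malgP => k; rewrite !(mcoeffD, mcoeffN); ring.
  apply: reduces_toD; first exact/reduces_to_ideal/PI_rel.
  apply: (subspaceB (reduces_to_subspace _)); apply: reduces_to_mon;
    rewrite /low /= bchildren_rspine ltnSn /=.
    exact: (pA' (BMul b w)).
  by apply: (pA' (BMul w b)); rewrite /= perm_catC.
have := IH (bvars (rspine x (w :: rs))) (perm_refl _).
move=> /(reduces_to_bmulr (w := b) (Q' := low (size rs).+2 A)).
rewrite /bmulr linextB !linext_mon /=; apply=> m /andP[km pm].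
rewrite /low /= ltnS km -(permPr pA) /= (permPl (perm_cat pm (perm_refl _))) /=.
by rewrite -!catA perm_cat2l perm_catC.
Qed.

Lemma bsort_low x rs A : perm_eq (bvars (rspine x rs)) A ->
  reduces_to (low (size rs) A) (mon F (rspine x rs) - mon F (rspine x (bsort rs))).
Proof.
elim: rs A => [|w rs IH] A pA; first by rewrite subrr; apply/reduces_to_ideal/PI_zero.
rewrite -[X in X - _](subrK (mon F (rspine x (w :: bsort rs)))) -addrA.
have pS : perm_eq (bvars (rspine x (bsort rs))) (bvars (rspine x rs)).
  rewrite (permPl (bvars_rspine _ _)) (permPr (bvars_rspine _ _)) perm_cons.
  exact/perm_flatten/perm_map/perm_bsort.
apply: reduces_toD.
  have := IH (bvars (rspine x rs)) (perm_refl _).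
  move=> /(reduces_to_bmulr (w := w) (Q' := low (size rs).+1 A)).
  rewrite /bmulr linextB !linext_mon /=; apply=> m /andP[km pm].
  by rewrite /low /= ltnS km -(permPr pA) /= (permPl (perm_cat pm (perm_refl _))).
rewrite /= -(perm_size (perm_bsort rs)); apply: binsert_low => /=.
by rewrite -(permPr pA) /= (permPl (perm_cat pS (perm_refl _))).
Qed.

Definition normal_on A m := normal m && perm_eq (bvars m) A.

(** The branches are replaced by their normal forms one at a time, [us1] being those already normal.
    A monomial is linear in each branch, and the ideal is stable under multiplication by the rest of
    the spine. *)
Lemma reduces_children Q x us1 us2 :
  (forall u, u \in us2 -> reduces_to (normal_on (bvars u)) (mon F u)) ->
  all normal us1 ->
  (forall rs, all normal rs -> size rs = size (us1 ++ us2) ->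
     perm_eq (bvars (rspine x rs)) (bvars (rspine x (us1 ++ us2))) ->
     reduces_to Q (mon F (rspine x rs))) ->
  reduces_to Q (mon F (rspine x (us1 ++ us2))).
Proof.
elim: us2 us1 => [|u us2 IH] us1 nu n1 hyp.
  by apply: hyp => //; rewrite all_cat n1.
have /nu ru : u \in u :: us2 by rewrite mem_head.
rewrite -(linext_mon (fun u => mon F (rspine x (us1 ++ u :: us2)))).
apply: reduces_to_linext ru => [f' If|u' /andP[nu' pu']].
  elim: us1 {n1 hyp} => [|b us1 IH1] /=; first exact: (PI_mull (rspine x us2)).
  suff -> : linext (fun u => mon F (BMul (rspine x (us1 ++ u :: us2)) b)) f' =
      bmulr b (linext (fun u => mon F (rspine x (us1 ++ u :: us2))) f').
    exact: PI_mulr.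
  by rewrite /bmulr linext_comp; apply: eq_in_linext => k _; rewrite linext_mon.
rewrite -cat_rcons; apply: IH => [w us2w||rs nrs srs prs].
- by apply: nu; rewrite inE us2w orbT.
- by rewrite all_rcons nu' n1.
apply: hyp => //; first by rewrite srs cat_rcons !size_cat.
rewrite (permPl prs) (permPl (bvars_rspine _ _)) (permPr (bvars_rspine _ _)).
rewrite cat_rcons !map_cat !flatten_cat /= perm_cons perm_cat2l.
by rewrite perm_cat2r.
Qed.

Lemma size_bchild m u : u \in bchildren m -> (size (bvars u) < size (bvars m))%N.
Proof.
elim: m => //= a IHa b _; rewrite inE size_cat => /orP[/eqP ->|/IHa lt_ua].
  by rewrite -add1n leq_add2r size_bvars.
exact: leq_trans lt_ua (leq_addr _ _).
Qed.

(** Induction on the number of letters, then on the number of branches: the branches have fewer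
    letters and can be made normal; sorting them leaves monomials in the same letters with fewer
    branches. *)
Lemma reduces_to_normal m : reduces_to (normal_on (bvars m)) (mon F m).
Proof.
move: {2}(size _) (leqnn (size (bvars m))) => N.
elim: N m => [|N IHN] m; first by rewrite leqNgt size_bvars.
move: {2}(size _) (leqnn (size (bchildren m))) => k.
elim/ltn_ind: k m => k IHk m le_mk le_mN.
rewrite -[in X in reduces_to _ X](rspineK m) -[bchildren m]cat0s.
apply: reduces_children => // [u /size_bchild lt_um|rs nrs srs prs].
  by apply: IHN; rewrite -ltnS (leq_trans lt_um).
rewrite /= rspineK in srs prs.
rewrite -[mon F (rspine _ rs)](subrK (mon F (rspine (bhead m) (bsort rs)))).
apply: reduces_toD.
  apply: reduces_to_trans (bsort_low prs) => m' /andP[lt_m'k pm'].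
  have lt_k : (size (bchildren m') < k)%N by rewrite (leq_trans lt_m'k) // srs.
  have := IHk _ lt_k m' (leqnn _); rewrite (perm_size pm') => /(_ le_mN).
  by apply: reduces_to_trans => m'' /andP[nm'' pm'']; apply: reduces_to_mon;
     rewrite /normal_on nm'' (permPl pm'').
apply: reduces_to_mon; rewrite /normal_on normal_rspine bsort_sorted andbT.
rewrite (perm_all _ (perm_bsort rs)) nrs /= -(permPr prs).
rewrite (permPl (bvars_rspine _ _)) (permPr (bvars_rspine _ _)) perm_cons.
exact/perm_flatten/perm_map/perm_bsort.
Qed.

End NormalForms.

(** * Coefficients of rooted trees *)

Section TimedMatrices.
Context (F : fieldType) (k N : nat).

Definition timed : Type := {ffun 'I_k -> 'M[F]_N}.
HB.instance Definition _ := GRing.Lmodule.on timed.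
Implicit Types x y z : timed.

Definition sum_ge x (t : 'I_k) : 'M[F]_N := \sum_(s : 'I_k | (t <= s)%N) x s.
Definition sum_gt x (t : 'I_k) : 'M[F]_N := \sum_(s : 'I_k | (t < s)%N) x s.

(** The product of two sums over time is split according to which factor has the earlier time, ties
    being counted in [timed_prec]. *)
Definition timed_prec x y : timed := [ffun t => x t *m sum_ge y t].
Definition timed_succ x y : timed := [ffun t => sum_gt x t *m y t].

Fact sum_ge_linear t : linear (sum_ge^~ t).
Proof.
move=> c x y; rewrite /sum_ge scaler_sumr -big_split.
by apply: eq_bigr => s _; rewrite !ffunE.
Qed.

Fact sum_gt_linear t : linear (sum_gt^~ t).
Proof.
move=> c x y; rewrite /sum_gt scaler_sumr -big_split.
by apply: eq_bigr => s _; rewrite !ffunE.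
Qed.

Fact timed_prec_linl y : linear (timed_prec^~ y).
Proof. by move=> c x x'; apply/ffunP => t; rewrite !ffunE mulmxDl scalemxAl. Qed.
Fact timed_prec_linr x : linear (timed_prec x).
Proof.
by move=> c y y'; apply/ffunP => t; rewrite !ffunE sum_ge_linear mulmxDr scalemxAr.
Qed.
Fact timed_succ_linl y : linear (timed_succ^~ y).
Proof.
by move=> c x x'; apply/ffunP => t; rewrite !ffunE sum_gt_linear mulmxDl scalemxAl.
Qed.
Fact timed_succ_linr x : linear (timed_succ x).
Proof. by move=> c y y'; apply/ffunP => t; rewrite !ffunE mulmxDr scalemxAr. Qed.

(* Splits a product of two tails according to which index comes first. *)
Lemma mul_tails (P : pred 'I_k) y z :
  (forall s r : 'I_k, P s -> (s <= r)%N -> P r) ->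
  (\sum_(s | P s) y s) *m (\sum_(s | P s) z s) =
  \sum_(s | P s) (timed_prec y z s + timed_succ y z s).
Proof.
move=> Pup; under [RHS]eq_bigr do rewrite !ffunE.
rewrite big_split /= mulmx_suml.
rewrite [X in _ = _ + X](eq_bigr (fun r : 'I_k => \sum_(s | P s && (r < s)%N) y s *m z r)).
  rewrite (exchange_big_dep P) => [|r s _ /andP[]//] /=.
  rewrite -big_split /=; apply: eq_bigr => s Ps.
  rewrite mulmx_sumr (bigID (fun r : 'I_k => (s <= r)%N)) /=; congr (_ + _).
    rewrite /sum_ge mulmx_sumr; apply: eq_bigl => r.
    by case: (leqP s r) => [/(Pup _ _ Ps) ->|]; rewrite ?andbF.
  by apply: eq_bigl => r; rewrite -ltnNge Ps andTb.
move=> r Pr; rewrite /sum_gt mulmx_suml; apply: eq_bigl => s.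
by case: (ltnP r s) => [/ltnW /(Pup _ _ Pr) ->|]; rewrite ?andbF.
Qed.

Fact timed_succprecA x y z :
  timed_prec (timed_succ x y) z = timed_succ x (timed_prec y z).
Proof. by apply/ffunP => t; rewrite !ffunE mulmxA. Qed.
Fact timed_precA x y z : timed_prec (timed_prec x y) z =
  timed_prec x (timed_prec y z) + timed_prec x (timed_succ y z).
Proof.
apply/ffunP => t; rewrite !ffunE -mulmxDr -mulmxA; congr (_ *m _).
rewrite [LHS]mul_tails => [|s r ts sr]; last exact: leq_trans ts sr.
by rewrite big_split.
Qed.
Fact timed_succA x y z : timed_succ x (timed_succ y z) =
  timed_succ (timed_succ x y) z + timed_succ (timed_prec x y) z.
Proof.
apply/ffunP => t; rewrite !ffunE -mulmxDl mulmxA; congr (_ *m _).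
rewrite [LHS]mul_tails => [|s r ts sr]; last exact: leq_trans ts sr.
by rewrite big_split /= addrC.
Qed.

HB.instance Definition _ := Lmodule_isDendriform.Build F timed
  timed_prec_linl timed_prec_linr timed_succ_linl timed_succ_linr
  timed_succprecA timed_precA timed_succA.

Lemma timed_prelieE x y t :
  prelie x y t = x t *m sum_ge y t - sum_gt y t *m x t.
Proof. by rewrite /prelie !ffunE. Qed.

End TimedMatrices.

(** * Rooted tree coefficients as matrix entries of pre-Lie values *)

Section TreeCoefficient.
Context (F : fieldType) (n : nat).
Local Notation X := 'I_n.
(* A rooted tree on the letters is given by its parent function [p]; the
   times [tau] grow away from the root. *)
Context (p : X -> option X) (tau : X -> X).
Hypothesis tau_inj : injective tau.
Hypothesis tau_parent : forall x y, p x = Some y -> (tau y < tau x)%N.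
Implicit Types (m a b : bmon X) (S A B : {set X}).

(* The coefficient, 0 or 1, of the tree [p] in the value of [m] in the free
   pre-Lie algebra of rooted trees. *)
Fixpoint grafts m : bool :=
  if m is BMul a b then
    [&& grafts a, grafts b & if p (bhead b) is Some y then y \in bvars a else false]
  else true.

(** In a product the parent of the head of the right factor is a letter of the left one, so by
    induction it is no earlier than the head of the left factor. *)
Lemma grafts_tau m y : grafts m -> y \in bvars m -> (tau (bhead m) <= tau y)%N.
Proof.
elim: m y => [x|a IHa b IHb] y /=; first by rewrite inE => _ /eqP ->.
case/and3P => ga gb; case def_p: (p (bhead b)) => [z|//] az.
rewrite mem_cat => /orP[/IHa -> //|/(IHb _ gb) le_by].
exact: leq_trans (ltnW (leq_ltn_trans (IHa z ga az) (tau_parent def_p))) le_by.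
Qed.

(** A root attaches to every set, in particular to the empty one, from which the final matrix entry
    starts. *)
Definition attaches S x := if p x is Some y then y \in S else true.

Local Notation N := #|{set X}|.
Local Notation st i := (@enum_val {set X} predT i).

(* The derivation of the commutative polynomial ring sending the variable of
   the parent of [x] to its product with all the variables in [A], written on
   square-free monomials. *)
Definition graft_mx A x : 'M[F]_N :=
  \matrix_(i < N, j < N) [&& [disjoint st i & A], attaches (st i) x
                   & st j == st i :|: A]%:R.

Lemma graft_mxM (A B : {set X}) x y i j : (graft_mx A x *m graft_mx B y) i j =
  [&& [disjoint st i & A], attaches (st i) x,
     [disjoint st i :|: A & B], attaches (st i :|: A) y
   & st j == st i :|: A :|: B]%:R.
Proof.
rewrite mxE (bigD1 (enum_rank (st i :|: A))) //= big1 => [|l neq_l].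
  by rewrite !mxE !enum_rankK eqxx andbT addr0 -natrM mulnb -!andbA.
rewrite !mxE; case: (st l =P _) => [def_l|_]; last by rewrite !andbF mul0r.
by rewrite -def_l enum_valK eqxx in neq_l.
Qed.

Lemma disjointsU1 (A B C : {set X}) :
  [disjoint A :|: B & C] = [disjoint A & C] && [disjoint B & C].
Proof. by rewrite -!setI_eq0 setIUl setU_eq0. Qed.

(** On a state [S] the two orders differ only in where [y] may attach: to S or [A] if [A] is
    adjoined first, to S alone otherwise. The difference is the case of a parent in [A], that is, of
    [B] grafted onto [A]. *)
Lemma graft_mx_comm A B x y :
    [disjoint A & B] -> (if p x is Some z then z \notin B else true) ->
  graft_mx A x *m graft_mx B y - graft_mx B y *m graft_mx A x =
  (if p y is Some z then z \in A else false)%:R *: graft_mx (A :|: B) x.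
Proof.
move=> dAB px; apply/matrixP => i j; rewrite mxE [X in _ + X]mxE !graft_mxM !mxE.
have ->: attaches (st i :|: B) x = attaches (st i) x.
  by rewrite /attaches; case: (p x) px => // z /negPf zB; rewrite inE zB orbF.
set S := st i; rewrite !disjointsU1 dAB [[disjoint B & A]]disjoint_sym dAB.
rewrite (_ : [disjoint S & A :|: B] = [disjoint S & A] && [disjoint S & B]);
  last by rewrite -!setI_eq0 setIUr setU_eq0.
rewrite -!setUA [B :|: A]setUC; rewrite !andbT.
have [dSA|] /= := boolP [disjoint S & A]; last by rewrite !andbF /= subrr mulr0.
have [dSB|] /= := boolP [disjoint S & B]; last by rewrite !andbF /= subrr mulr0.
case: (_ == _); last by rewrite !andbF subrr mulr0.
rewrite !andbT /attaches; case: (p y) => [z|]; last by rewrite /= andbT subrr mul0r.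
rewrite inE; have [zA|] := boolP (z \in A); last by rewrite orbF andbC subrr mul0r.
have -> : z \in S = false by apply: contraTF zA => zS; rewrite (disjointFr dSA).
by rewrite orbT /= andbT subr0 mul1r.
Qed.

Definition letter_value (x : X) : timed F n N :=
  [ffun t => (t == tau x)%:R *: graft_mx [set x] x].

(** The value of a monomial is concentrated at the time of its head. If the head of [a] precedes
    that of [b], both tails of the value of [b] are the whole value and the product is a commutator,
    given by [graft_mx_comm]. Otherwise both tails vanish, and no letter of [a] is early enough to
    be the parent of the head of [b]. *)
Lemma prelie_letters m : uniq (bvars m) ->
  beval (@prelie F _) letter_value m =
  [ffun t => ((t == tau (bhead m)) && grafts m)%:R
             *: graft_mx [set x in bvars m] (bhead m)] :> timed F n N.
Proof.
elim: m => [x|a IHa b IHb] /= uab.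
  by apply/ffunP => t; rewrite !ffunE andbT set_cons set_nil setU0.
move: uab; rewrite cat_uniq => /and3P[ua dab ub].
rewrite {}IHa // {}IHb //; set va := finfun _; set vb := finfun _.
set A := [set x in bvars a]; set B := [set x in bvars b].
have dAB : [disjoint A & B].
  rewrite disjoint_subset; apply/subsetP => x; rewrite !inE => ax.
  by apply: contra dab => bx; apply/hasP; exists x.
have neq_tau : tau (bhead b) != tau (bhead a).
  rewrite (inj_eq tau_inj); apply: contra dab => /eqP eq_ab.
  by apply/hasP; exists (bhead b); rewrite ?bhead_vars //= eq_ab bhead_vars.
have sum_vb (P : pred X) : \sum_(s | P s) vb s =
    (P (tau (bhead b)) && grafts b)%:R *: graft_mx B (bhead b).
  rewrite (bigID (pred1 (tau (bhead b)))) /= [X in _ + X]big1 ?addr0; last first.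
    by move=> s /andP[_ /negPf ne]; rewrite ffunE ne scale0r.
  rewrite big_mkcondr big_mkcond (bigD1 (tau (bhead b))) //= big1 ?addr0.
    by rewrite eqxx; case: (P _); rewrite ?scale0r // ffunE eqxx.
  by move=> s /negPf ->; case: (P s).
apply/ffunP => t; rewrite timed_prelieE /sum_ge /sum_gt !sum_vb !ffunE.
have [->|] := eqVneq t (tau (bhead a)); last by rewrite !scale0r mul0mx mulmx0 subrr.
(* The heads have distinct times, so the weak and the strict tail agree. *)
rewrite andTb leq_eqVlt eq_sym (inj_eq val_inj) (negPf neq_tau) /=.
have -> : [set x in bvars a ++ bvars b] = A :|: B.
  by apply/setP => x; rewrite !inE mem_cat.
have [ga|] := boolP (grafts a); last by rewrite !scale0r mul0mx mulmx0 subrr.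
have [gb|] := boolP (grafts b); last by rewrite !andbF !scale0r mul0mx mulmx0 subrr.
rewrite !scale1r andbT /=; case: ltnP => [lt_ab|le_ba].
  rewrite !scale1r graft_mx_comm //; last first.
    case def_p: (p (bhead a)) => [z|//]; rewrite inE; apply/negP => /(grafts_tau gb).
    by rewrite leqNgt (ltn_trans (tau_parent def_p) lt_ab).
  by case: (p (bhead b)) => [z|//]; rewrite inE.
rewrite !scale0r mulmx0 mul0mx subrr.
case def_p: (p (bhead b)) => [z|]; last by rewrite scale0r.
case: (boolP (z \in bvars a)) => [/(grafts_tau ga) le_az|]; last by rewrite scale0r.
by have := leq_ltn_trans le_az (tau_parent def_p); rewrite ltnNge le_ba.
Qed.

(** The linear form [phi] takes the matrix entry from the empty state to the full one, summed over
    all times. On the value of a multilinear monomial it is the coefficient [grafts m]. *)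
Lemma dendriform_kernel_grafts (g : {malg F[bmon X]}) :
  {in msupp g, forall m, perm_eq (bvars m) (enum X)} ->
  (forall (D : dendType F) (v : X -> D), linext (beval (@prelie F D) v) g = 0) ->
  \sum_(m <- msupp g) g@_m * (grafts m)%:R = 0.
Proof.
move=> gX g0; pose i0 := enum_rank (set0 : {set X}); pose i1 := enum_rank [set: X].
pose phi (d : timed F n N) : F^o := \sum_t d t i0 i1.
have phi_lin : linear phi.
  move=> c d d'; rewrite /phi scaler_sumr -big_split.
  by apply: eq_bigr => t _; rewrite !ffunE !mxE.
have : phi (linext (beval (@prelie F _) letter_value) g) = 0.
  rewrite g0 /phi big1 // => t _; by rewrite ffunE mxE.
rewrite linear_linext // => phi0; rewrite -{}[RHS]phi0 /linext.
apply: eq_big_seq => m /gX pm.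
have um : uniq (bvars m) by rewrite (perm_uniq pm) enum_uniq.
have setm : [set x in bvars m] = [set: X].
  by apply/setP => x; rewrite !inE (perm_mem pm) mem_enum.
rewrite prelie_letters // /phi; congr (_ * _).
rewrite (bigD1 (tau (bhead m))) //= big1 => [|t /negPf net]; last first.
  by rewrite ffunE net scale0r mxE.
rewrite ffunE eqxx addr0 setm !mxE !enum_rankK set0U eqxx andbT.
rewrite -setI_eq0 set0I eqxx /=; case: (boolP (grafts m)) => [gm|]; rewrite ?mul0r //.
(* The head must be the root: a parent would be an earlier letter of [m], against [grafts_tau]. *)
rewrite /attaches; case def_p: (p _) => [y|]; rewrite ?mulr1 //.
have := grafts_tau gm (_ : y \in bvars m); rewrite (perm_mem pm) mem_enum => /(_ isT).
by rewrite leqNgt (tau_parent def_p).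
Qed.

End TreeCoefficient.

(** * The tree of a monomial and triangularity for its ancestor relation *)

Section ParentFunctions.
Context (n : nat).
Local Notation X := 'I_n.
Implicit Types (m a b : bmon X) (x y z : X).

Fixpoint bparent m x : option X :=
  if m is BMul a b then
    if x \in bvars b then
      if x == bhead b then Some (bhead a) else bparent b x
    else bparent a x
  else None.

Lemma uniq_bmul a b : uniq (bvars (BMul a b)) ->
  [/\ uniq (bvars a), uniq (bvars b)
    & forall z, z \in bvars b -> z \in bvars a = false].
Proof.
rewrite /= cat_uniq => /and3P[ua dab ub]; split=> // z bz.
by apply: contraNF dab => az; apply/hasP; exists z.
Qed.

(** A parent is the head of a left factor, hence read before its child. The reading order will thus
    serve as the time [tau]. *)
Lemma bparent_index m x y : uniq (bvars m) -> bparent m x = Some y ->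
  [/\ x \in bvars m, y \in bvars m
    & (index y (bvars m) < index x (bvars m))%N].
Proof.
elim: m => // a IHa b IHb /uniq_bmul[ua ub notin] /=.
case: ifP => [bx|_].
  case: eqP => [_ [<-]|_ /(IHb ub) [_ bz lt]].
    rewrite !mem_cat bx bhead_vars orbT !index_cat bhead_vars notin //.
    by rewrite (leq_trans _ (leq_addr _ _)) // index_mem bhead_vars.
  by rewrite !mem_cat bx bz !orbT !index_cat !notin // ltn_add2l.
by move=> /(IHa ua) [ax az lt]; rewrite !mem_cat ax az !index_cat ax az.
Qed.

Lemma eq_in_grafts (p q : X -> option X) m : uniq (bvars m) ->
  {in bvars m, forall x, x != bhead m -> p x = q x} -> grafts p m = grafts q m.
Proof.
elim: m => // a IHa b IHb /uniq_bmul[ua ub notin] /= pq.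
rewrite IHa ?IHb // => [|x bx _|x ax neq].
- rewrite pq // ?mem_cat ?bhead_vars ?orbT //.
  by apply: contraFneq (notin _ (bhead_vars b)) => ->; apply: bhead_vars.
- apply: pq; first by rewrite mem_cat bx orbT.
  by apply: contraFneq (notin _ bx) => ->; apply: bhead_vars.
- by apply: pq; rewrite ?mem_cat ?ax.
Qed.

(** The diagonal of the triangular system. *)
Lemma grafts_bparent m : uniq (bvars m) -> grafts (bparent m) m.
Proof.
elim: m => // a IHa b IHb /uniq_bmul[ua ub notin] /=.
rewrite bhead_vars eqxx bhead_vars andbT; apply/andP; split.
  rewrite (eq_in_grafts (q := bparent a)) ?IHa // => x ax _.
  by case: ifP => // /notin; rewrite ax.
by rewrite (eq_in_grafts (q := bparent b)) ?IHb // => x -> /negPf ->.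
Qed.

(* The pairs (strict ancestor, descendant) of the tree of [m]. *)
Fixpoint bpairs m : seq (X * X) :=
  if m is BMul a b then
    bpairs a ++ bpairs b ++ [seq (bhead a, y) | y <- bvars b]
  else [::].

Lemma mem_head_pairs a b x y : (x, y) \in [seq (bhead a, z) | z <- bvars b] =
  (x == bhead a) && (y \in bvars b).
Proof.
apply/mapP/andP => [[z bz [-> ->]] //|[/eqP -> by_]].
by exists y.
Qed.

Lemma mem_bpairs m x y : (x, y) \in bpairs m -> x \in bvars m /\ y \in bvars m.
Proof.
elim: m x y => //= a IHa b IHb x y; rewrite !mem_cat mem_head_pairs.
by case/or3P => [/IHa[-> ->]|/IHb[-> ->]|/andP[/eqP -> ->]]; rewrite ?bhead_vars ?orbT.
Qed.

Lemma bpairs_neq_head m x y : uniq (bvars m) -> (x, y) \in bpairs m -> y != bhead m.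
Proof.
elim: m x y => // a IHa b IHb x y /uniq_bmul[ua ub notin] /=.
have neq z : z \in bvars b -> z != bhead a.
  by move=> bz; apply: contraFneq (notin _ bz) => ->; apply: bhead_vars.
rewrite !mem_cat mem_head_pairs.
by case/or3P => [/IHa -> //|/mem_bpairs[_ /neq]|/andP[_ /neq]].
Qed.

Lemma bpairs_head m y : y \in bvars m -> y != bhead m -> (bhead m, y) \in bpairs m.
Proof.
elim: m => [x|a IHa b _] /=; first by rewrite inE => /eqP ->; rewrite eqxx.
rewrite !mem_cat mem_head_pairs eqxx /= => /orP[ay|->]; last by rewrite !orbT.
by move=> /(IHa ay) ->.
Qed.

Lemma uniq_bpairs m : uniq (bvars m) -> uniq (bpairs m).
Proof.
elim: m => // a IHa b IHb /uniq_bmul[ua ub notin] /=.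
rewrite !cat_uniq IHa // IHb // map_inj_uniq ?ub => [|x y [] //].
rewrite !andbT /=; apply/andP; split; apply/hasP => -[[x y]].
  rewrite mem_cat mem_head_pairs => ab /mem_bpairs[_ ay].
  by case/orP: ab => [/mem_bpairs[_]|/andP[_]] /notin; rewrite ay.
rewrite mem_head_pairs => /andP[/eqP -> _] /mem_bpairs[/notin].
by rewrite bhead_vars.
Qed.

Lemma bpairs_trans m x y z : uniq (bvars m) ->
  (x, y) \in bpairs m -> (y, z) \in bpairs m -> (x, z) \in bpairs m.
Proof.
elim: m x y z => // a IHa b IHb x y z /uniq_bmul[ua ub notin] /=.
rewrite !mem_cat !mem_head_pairs.
case/or3P => [axy|bxy|/andP[/eqP -> by_]].
- have [_ ay] := mem_bpairs axy.
  case/or3P => [ayz|/mem_bpairs[/notin]|/andP[/eqP eqy]]; last 2 first.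
  + by rewrite ay.
  + by have := bpairs_neq_head ua axy; rewrite eqy eqxx.
  by rewrite (IHa x y z).
- have [_ by_] := mem_bpairs bxy.
  case/or3P => [/mem_bpairs[]|byz|/andP[/eqP eqy]].
  + by rewrite notin.
  + by rewrite (IHb x y z) ?orbT.
  + by have := notin _ by_; rewrite eqy bhead_vars.
case/or3P => [/mem_bpairs[]|byz|/andP[/eqP eqy]].
- by rewrite notin.
- by have [_ ->] := mem_bpairs byz; rewrite eqxx !orbT.
- by have := notin _ by_; rewrite eqy bhead_vars.
Qed.

Lemma bparent_bpairs m x y : bparent m x = Some y -> (y, x) \in bpairs m.
Proof.
elim: m => //= a IHa b IHb; rewrite !mem_cat mem_head_pairs.
case: ifP => [_|_ /IHa -> //].
by case: eqP => [_ [<-]|_ /IHb ->]; rewrite ?eqxx !orbT.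
Qed.

(** The off-diagonal part of triangularity. The induction also shows that the head of [m] is above
    its other letters in the tree of [m0]: the parent z of the head of [b] is the head of [a] or
    below it, so by transitivity the head of [a] is above all of [b]. *)
Lemma grafts_bpairs m0 m : uniq (bvars m0) -> grafts (bparent m0) m ->
  {subset bpairs m <= bpairs m0}.
Proof.
move=> u0; suff: grafts (bparent m0) m ->
    {in bvars m, forall y, y != bhead m -> (bhead m, y) \in bpairs m0}
    /\ {subset bpairs m <= bpairs m0} by move=> h /h[].
elim: m => [x _|a IHa b IHb] /=; first by split=> // y; rewrite inE => ->.
case/and3P => /IHa[ha sa] /IHb[hb sb]; case def_p: (bparent _ _) => [z|//] az.
have headab y : y \in bvars b -> (bhead a, y) \in bpairs m0.
  move=> by_; have pz := bparent_bpairs def_p.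
  have pb : (bhead a, bhead b) \in bpairs m0.
    have [<- //|neq] := eqVneq z (bhead a).
    by apply: bpairs_trans pz => //; apply: ha.
  have [-> //|neq] := eqVneq y (bhead b).
  by apply: bpairs_trans pb _ => //; apply: hb.
split=> [y|[x y]].
  by rewrite mem_cat => /orP[ay /(ha _ ay)|/headab].
rewrite !mem_cat mem_head_pairs.
by case/or3P => [/sa|/sb|/andP[/eqP -> /headab]].
Qed.

(** A letter whose only strict ancestor is the root is the head of a branch, and the branches of a
    normal monomial are ordered by their heads, the last being the greatest. *)
Lemma normal_last_child a b y :
  uniq (bvars (BMul a b)) -> normal (BMul a b) -> y \in bvars (BMul a b) ->
  y != bhead a -> (forall x, (x, y) \in bpairs (BMul a b) -> x = bhead a) ->
  (y <= bhead b)%N.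
Proof.
elim: a b => [x|a1 IH b1 _] b um nm ym neq child;
  have [ua ub notin] := uniq_bmul um.
  move: ym; rewrite /= inE => /orP[/eqP eqx|by_]; first by rewrite eqx eqxx in neq.
  have [-> //|neqb] := eqVneq y (bhead b).
  have := child (bhead b); rewrite !mem_cat bpairs_head // => /(_ isT) eqb.
  by have := notin _ (bhead_vars b); rewrite /= eqb inE eqxx.
move: nm => /and3P[na nb le_b1b].
move: ym; rewrite -[bvars _]/(bvars (BMul a1 b1) ++ bvars b) mem_cat.
case/orP => [ay|by_].
  apply: leq_trans le_b1b; apply: IH => // x xy; apply: child.
  by rewrite -[bpairs _]/(bpairs (BMul a1 b1) ++ _) mem_cat xy.
have [-> //|neqb] := eqVneq y (bhead b).
have := child (bhead b); rewrite -[bpairs _]/(bpairs (BMul a1 b1) ++ _) !mem_cat.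
rewrite [(_, _) \in bpairs b]bpairs_head // orTb orbT => /(_ isT) eqb.
by have := notin _ (bhead_vars b); rewrite eqb bhead_vars.
Qed.

Lemma mem_bpairsr a b x y : uniq (bvars (BMul a b)) -> x \in bvars b ->
  ((x, y) \in bpairs b) = ((x, y) \in bpairs (BMul a b)).
Proof.
case/uniq_bmul=> ua ub notin bx; rewrite /= !mem_cat mem_head_pairs.
have -> : (x, y) \in bpairs a = false.
  by apply: contraFF (notin _ bx) => /mem_bpairs[].
by case: eqP (notin _ bx) => [->|]; rewrite ?bhead_vars ?orbF.
Qed.

Lemma mem_bpairsl a b x y : uniq (bvars (BMul a b)) -> y \in bvars a ->
  ((x, y) \in bpairs a) = ((x, y) \in bpairs (BMul a b)).
Proof.
case/uniq_bmul=> ua ub notin ay; rewrite /= !mem_cat mem_head_pairs.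
have by_ : y \in bvars b = false by apply: contraTF ay => /notin ->.
by rewrite by_ andbF; case: (boolP (_ \in bpairs b)) => [/mem_bpairs[]|]; rewrite ?by_ ?orbF.
Qed.

Lemma mem_last_child a b y : uniq (bvars (BMul a b)) ->
  (y \in bvars b) = (y == bhead b) || ((bhead b, y) \in bpairs (BMul a b)).
Proof.
move=> uab; rewrite -mem_bpairsr ?bhead_vars //.
have [-> | neq] := eqVneq y (bhead b); first exact: bhead_vars.
by apply/idP/idP => [/bpairs_head -> //|/mem_bpairs[]].
Qed.

Lemma child_last a b x : uniq (bvars (BMul a b)) ->
  (x, bhead b) \in bpairs (BMul a b) -> x = bhead a.
Proof.
case/uniq_bmul=> ua ub notin; rewrite /= !mem_cat mem_head_pairs.
case/or3P => [/mem_bpairs[_]|/(bpairs_neq_head ub)|/andP[/eqP -> //]].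
  by rewrite notin // bhead_vars.
by rewrite eqxx.
Qed.

(** The ancestor relation determines the head, as the letter without ancestors; then the head of the
    last branch, by [normal_last_child]; then the letters of that branch, as the descendants of its
    head. It restricts to both factors, to which induction applies. *)
Lemma normal_bpairs_inj m m0 : uniq (bvars m) -> normal m -> normal m0 ->
  perm_eq (bvars m) (bvars m0) -> bpairs m =i bpairs m0 -> m = m0.
Proof.
elim: m m0 => [x|a IHa b IHb] m0 um nm nm0 pm eqp.
  case: m0 {nm0 eqp} pm => [y /perm_mem/(_ y)|a b /perm_size] /=.
    by rewrite !inE eqxx => /eqP ->.
  by rewrite size_cat => s1; have := leq_add (size_bvars a) (size_bvars b); rewrite -s1.
case: m0 nm0 pm eqp => [y _ /perm_size|a' b' nm0 pm eqp].
  by rewrite /= size_cat => s1; have := leq_add (size_bvars a) (size_bvars b); rewrite s1.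
have um0 : uniq (bvars (BMul a' b')) by rewrite -(perm_uniq pm).
have eq_head : bhead (BMul a b) = bhead (BMul a' b').
  apply/eqP; apply: contraT => neq.
  have : (bhead (BMul a b), bhead (BMul a' b')) \in bpairs (BMul a b).
    by rewrite bpairs_head ?(perm_mem pm) ?bhead_vars // eq_sym.
  by rewrite eqp => /(bpairs_neq_head um0); rewrite eqxx.
have last_le c d c' d' : uniq (bvars (BMul c d)) -> normal (BMul c d) ->
    uniq (bvars (BMul c' d')) ->
    bvars (BMul c d) =i bvars (BMul c' d') ->
    bpairs (BMul c d) =i bpairs (BMul c' d') ->
    bhead (BMul c d) = bhead (BMul c' d') -> (bhead d' <= bhead d)%N.
  move=> u nrm u' eqv eqp' eqh; apply: (@normal_last_child c d) => //.
  - by rewrite eqv mem_cat bhead_vars orbT.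
  - rewrite -[bhead c]/(bhead (BMul c d)) eqh; have [_ _ notin] := uniq_bmul u'.
    by apply: contraFneq (notin _ (bhead_vars d')) => ->; apply: bhead_vars.
  - by move=> x; rewrite eqp' -[bhead c]/(bhead (BMul c d)) eqh => /(child_last u').
have eq_last : bhead b = bhead b'.
  apply/val_inj/eqP; rewrite /= eqn_leq; apply/andP; split.
    by apply: (@last_le a' b' a b) => // x; rewrite ?(perm_mem pm) ?eqp.
  by apply: (@last_le a b a' b') => //; apply: perm_mem.
have eqvb : bvars b =i bvars b'.
  by move=> y; rewrite (mem_last_child _ um) (mem_last_child _ um0) eq_last eqp.
have [ua ub notin] := uniq_bmul um; have [ua' ub' notin'] := uniq_bmul um0.
have pb : perm_eq (bvars b) (bvars b') by apply: uniq_perm.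
have pa : perm_eq (bvars a) (bvars a').
  by move: pm; rewrite /= -(permPr (perm_cat (perm_refl _) pb)) perm_cat2r.
move: (nm) (nm0) => /= /and3P[na nb _] /and3P[na0 nb0 _].
congr BMul.
  apply: IHa => // -[x y]; have [ay|nay] := boolP (y \in bvars a).
    by rewrite (mem_bpairsl _ um) // (mem_bpairsl _ um0) -?(perm_mem pa).
  apply/idP/idP => /mem_bpairs[_]; first by rewrite (negPf nay).
  by rewrite -(perm_mem pa) (negPf nay).
apply: IHb => // -[x y]; have [bx|nbx] := boolP (x \in bvars b).
  by rewrite (mem_bpairsr _ um) // (mem_bpairsr _ um0) -?(perm_mem pb).
apply/idP/idP => /mem_bpairs[]; first by rewrite (negPf nbx).
by rewrite -(perm_mem pb) (negPf nbx).
Qed.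

End ParentFunctions.

(** * The pre-Lie product of a dendriform dialgebra *)

Section DendriformPreLie.
Context (F : fieldType) (D : dendType F).
Implicit Types x y z : D.

Fact prelie_linl y : linear (fun x : D => prelie x y).
Proof.
move=> c x x'; rewrite /prelie dprec_linl dsucc_linr scalerBr opprD !addrA.
by congr (_ - _); rewrite addrAC.
Qed.

Fact prelie_linr x : linear (prelie x).
Proof.
move=> c y y'; rewrite /prelie dprec_linr dsucc_linl scalerBr opprD !addrA.
by congr (_ - _); rewrite addrAC.
Qed.

(** In this form the associator is symmetric in [y] and [z] up to the order of the summands. *)
Lemma prelie_assocE x y z :
  prelie (prelie x y) z - prelie x (prelie y z) =
  dprec x (dsucc y z) + dprec x (dsucc z y)
  - (dsucc y (dprec x z) + dsucc z (dprec x y))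
  + (dsucc (dprec z y) x + dsucc (dprec y z) x).
Proof.
rewrite /prelie !(linB (dprec_linl _), linB (dprec_linr _)).
rewrite !(linB (dsucc_linl _), linB (dsucc_linr _)).
rewrite dprecA dsuccprecA dsuccA !opprB opprD !addrA.
set a := dprec x (dprec y z); set e := dsucc (dsucc z y) x.
(* The reordering brings [a] next to its opposite, and [e] next to its own. *)
rewrite [LHS](ACl (1*10*(4*8)*2*9*3*6*5*7)) /=.
by rewrite !addrN !add0r.
Qed.

Lemma prelie_rel x y z : prelie (prelie x y) z - prelie x (prelie y z)
  - (prelie (prelie x z) y - prelie x (prelie z y)) = 0.
Proof.
rewrite !prelie_assocE [dprec x (dsucc z y) + _]addrC.
by rewrite [dsucc z _ + _]addrC [dsucc (dprec y z) x + _]addrC subrr.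
Qed.

End DendriformPreLie.

(** * Multilinear identities of the pre-Lie product in dendriform dialgebras *)

Section Kernel.
Context (F : fieldType) (n : nat).
Local Notation X := 'I_n.
Implicit Types (f g : {malg F[bmon X]}).

Lemma prelie_ideal_eval0 f (D : dendType F) (v : X -> D) :
  prelie_ideal f -> linext (beval (@prelie F D) v) f = 0.
Proof.
apply: (beval_prelie_ideal (P := fun u => u = 0)).
- exact: prelie_linl.
- exact: prelie_linr.
- by split=> [//|u w -> ->|c u ->]; rewrite ?addr0 ?scaler0.
- by move=> u m ->; rewrite -[X in prelie X _](subrr 0) (linB (prelie_linl _)) subrr.
- by move=> u m ->; rewrite -[X in prelie _ X](subrr 0) (linB (prelie_linr _)) subrr.
- by move=> a b c; apply: prelie_rel.
Qed.

(** Otherwise choose in the support a monomial [m0] with the fewest ancestor pairs and take the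
    coefficient of its tree. If this tree occurs in [m], the pairs of [m] are among those of [m0],
    hence the same by minimality, and [m] is [m0]. So the coefficient of [m0] in [g] is zero, a
    contradiction. *)
Lemma normal_kernel0 g :
  {in msupp g, forall m, normal m && perm_eq (bvars m) (enum X)} ->
  (forall (D : dendType F) (v : X -> D), linext (beval (@prelie F D) v) g = 0) ->
  g = 0.
Proof.
move=> sg g0; have [gs0|/fset0Pn[m1 gm1]] := eqVneq (msupp g) fset0.
  by apply/malgP => m; rewrite mcoeff_outdom ?gs0 // mcoeff0.
pose wt (m : bmon X) := size (bpairs m).
have [m0 gm0 min0] : exists2 m0, m0 \in msupp g &
    forall m, m \in msupp g -> (wt m0 <= wt m)%N.
  have exw : exists w, has (fun m => wt m == w) (msupp g).
    by exists (wt m1); apply/hasP; exists m1.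
  case: (ex_minnP exw) => w /hasP[m0 gm0 /eqP <-] minw.
  by exists m0 => // m gm; apply: minw; apply/hasP; exists m.
have /andP[nm0 pm0] := sg _ gm0.
have u0 : uniq (bvars m0) by rewrite (perm_uniq pm0) enum_uniq.
have idx x : (index x (bvars m0) < n)%N.
  have := index_mem x (bvars m0); rewrite (perm_size pm0) size_enum_ord => ->.
  by rewrite (perm_mem pm0) mem_enum.
(* The time of a letter is its position in [m0]. *)
pose tau x := Ordinal (idx x).
have tau_inj : injective tau.
  have mem0 z : z \in bvars m0 by rewrite (perm_mem pm0) mem_enum.
  by move=> x y [eqxy]; rewrite -(nth_index x (mem0 x)) eqxy nth_index.
have tau_par x y : bparent m0 x = Some y -> (tau y < tau x)%N.
  by case/(bparent_index u0).
have gX : {in msupp g, forall m, perm_eq (bvars m) (enum X)} by move=> m /sg/andP[].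
have := dendriform_kernel_grafts tau_inj tau_par gX g0.
rewrite (big_fsetD1 m0) //= grafts_bparent // mulr1 big_seq big1.
  by rewrite addr0 => /eqP; rewrite mcoeff_eq0 gm0.
move=> m; rewrite in_fsetD1 => /andP[neq gm].
case: (boolP (grafts _ m)) => [/(grafts_bpairs u0) sub|_]; last by rewrite mulr0.
have /andP[nm pm] := sg _ gm.
have um : uniq (bvars m) by rewrite (perm_uniq pm) enum_uniq.
have [_ eqp] := uniq_min_size (uniq_bpairs um) sub (min0 _ gm).
case/eqP: neq; apply: normal_bpairs_inj => //.
by rewrite (permPl pm) perm_sym.
Qed.

(** Modulo the ideal [f] is a combination [g] of normal monomials. The ideal vanishes in every
    dendriform dialgebra, so [g] does too, and is zero. *)
Theorem prelie_kernel f :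
  {in msupp f, forall m, perm_eq (bvars m) (enum X)} ->
  (forall (D : dendType F) (v : X -> D), linext (beval (@prelie F D) v) f = 0) ->
  prelie_ideal f.
Proof.
move=> sf f0.
have [g sg If] : reduces_to (normal_on (enum X)) f.
  rewrite -[f]linext_mon_id.
  apply: (subspace_linext (P := reduces_to _)); first exact: reduces_to_subspace.
  move=> m /sf pm.
  apply: reduces_to_trans (reduces_to_normal F m) => m' /andP[nm' pm'].
  by apply: reduces_to_mon; rewrite /normal_on nm' (permPl pm').
suff g0 : g = 0 by rewrite -[f]subr0 -g0.
apply: normal_kernel0 => // D v.
by have /eqP := prelie_ideal_eval0 v If; rewrite linextB f0 sub0r oppr_eq0 => /eqP.
Qed.

End Kernel.

(** * Liftings *)

Section TripleSubstitution.
Context (F : fieldType).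

Fixpoint tbind (X Y : Type) (s : X -> tmon Y) (m : tmon X) : tmon Y :=
  match m with
  | TVar x => s x
  | TOp i a b c => TOp i (tbind s a) (tbind s b) (tbind s c)
  end.

Lemma tvars_tbind (X Y : Type) (s : X -> tmon Y) m :
  tvars (tbind s m) = flatten [seq tvars (s x) | x <- tvars m].
Proof.
by elim: m => /= [x|i a -> b -> c ->]; rewrite ?cats0 // !map_cat !flatten_cat.
Qed.

Lemma tbind_comp (X Y Z : Type) (s : Y -> tmon Z) (s' : X -> tmon Y) m :
  tbind s (tbind s' m) = tbind (fun x => tbind s (s' x)) m.
Proof. by elim: m => //= i a -> b -> c ->. Qed.

Lemma eq_in_tbind (X : eqType) (Y : Type) (s s' : X -> tmon Y) m :
  {in tvars m, s =1 s'} -> tbind s m = tbind s' m.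
Proof.
elim: m => /= [x|i a IHa b IHb c IHc] e; first by rewrite e ?mem_head.
by rewrite IHa ?IHb ?IHc // => x mx; apply: e; rewrite !mem_cat mx ?orbT.
Qed.

Lemma tmon_eval_tbind (X Y V : Type) (op : bool -> V -> V -> V -> V) (v : Y -> V)
    (s : X -> tmon Y) m :
  tmon_eval op v (tbind s m) = tmon_eval op (fun x => tmon_eval op v (s x)) m.
Proof. by elim: m => //= i a -> b -> c ->. Qed.

Lemma size_tvars (X : Type) (m : tmon X) : odd (size (tvars m)).
Proof. by elim: m => //= i a + b + c; rewrite !size_cat !oddD => -> -> ->. Qed.

Lemma tvars_gt0 (X : Type) (m : tmon X) : (0 < size (tvars m))%N.
Proof. by case: size (size_tvars m). Qed.

Definition tsub (X Y : choiceType) (s : X -> tmon Y) (f : freeTriple F X) :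
  freeTriple F Y := linext (fun m => mon F (tbind s m)) f.

Lemma tsub_comp (X Y Z : choiceType) (s : Y -> tmon Z) (s' : X -> tmon Y) f :
  tsub s (tsub s' f) = tsub (fun x => tbind s (s' x)) f.
Proof.
rewrite /tsub linext_comp; apply: eq_in_linext => m _.
by rewrite linext_mon tbind_comp.
Qed.

Lemma eq_in_tsub (X Y : choiceType) (s s' : X -> tmon Y) (f : freeTriple F X) :
  (forall m, m \in msupp f -> {in tvars m, s =1 s'}) -> tsub s f = tsub s' f.
Proof. by move=> e; apply: eq_in_linext => m /e /eq_in_tbind ->. Qed.

Lemma tvarE (X : choiceType) (x : X) : tvar F x = mon F (TVar x).
Proof. by rewrite mon.unlock. Qed.

Lemma tprodE (X : choiceType) i (f g h : freeTriple F X) : tprod i f g h =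
  linext (fun a => linext (fun b => linext (fun c => mon F (TOp i a b c)) h) g) f.
Proof. by rewrite mon.unlock. Qed.

Lemma tprod_mon (X : choiceType) i (a b c : tmon X) :
  tprod i (mon F a) (mon F b) (mon F c) = mon F (TOp i a b c).
Proof. by rewrite tprodE !linext_mon. Qed.

Lemma tsubst_mon (X Y : choiceType) (s : X -> freeTriple F Y) (s' : X -> tmon Y) f :
  (forall x, s x = mon F (s' x)) -> tsubst s f = tsub s' f.
Proof.
move=> e; apply: eq_in_linext => m _.
by elim: m => [x|i a IHa b IHb c IHc] //=; rewrite IHa IHb IHc tprod_mon.
Qed.

Lemma supported_tsub (X Y : choiceType) (s : X -> tmon Y) (f : freeTriple F X)
    (Q : pred (tmon Y)) :
  (forall m, m \in msupp f -> Q (tbind s m)) -> {in msupp (tsub s f), forall m, Q m}.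
Proof. by move=> sQ; apply: supported_linext => m /sQ; apply: supported_mon. Qed.

(* The factor [a] is in position [q], every [q >= 2] meaning the last one. *)
Definition tins (X : Type) (q : nat) (i : bool) (a b c : tmon X) : tmon X :=
  match q with 0 => TOp i a b c | 1 => TOp i b a c | _ => TOp i b c a end.

Lemma tins_tprod (X : choiceType) q i (f : freeTriple F X) b c :
  linext (fun a => mon F (tins q i a b c)) f =
  match q with
  | 0 => tprod i f (mon F b) (mon F c)
  | 1 => tprod i (mon F b) f (mon F c)
  | _ => tprod i (mon F b) (mon F c) f
  end.
Proof.
case: q => [|[|q]];
  [rewrite [RHS]tprodE|rewrite [RHS]tprodE linext_mon|rewrite [RHS]tprodE].
- by apply: eq_in_linext => a _; rewrite linext_mon linext_mon.
- by apply: eq_in_linext => a _; rewrite linext_mon.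
- by rewrite linext_mon linext_mon.
Qed.

Lemma tvars_tins (X : eqType) q i (a b c : tmon X) :
  perm_eq (tvars (tins q i a b c)) (tvars a ++ tvars b ++ tvars c).
Proof.
case: q => [//|[|q]] /=; first by rewrite perm_catCA.
by rewrite catA perm_catC.
Qed.

Lemma tbind_tins (X Y : Type) (s : X -> tmon Y) q i a b c :
  tbind s (tins q i a b c) = tins q i (tbind s a) (tbind s b) (tbind s c).
Proof. by case: q => [|[|q]]. Qed.

(** The substitution made by a lifting, with arbitrary names for the letters. *)
Definition tsubop (X : eqType) (u : X) (j : bool) (v w x : X) : tmon X :=
  if x == u then TOp j (TVar u) (TVar v) (TVar w) else TVar x.

Lemma tbind_tsubop_id (X : eqType) (u : X) j v w m :
  u \notin tvars m -> tbind (tsubop u j v w) m = m.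
Proof.
move=> num; rewrite (eq_in_tbind (s' := @TVar X)) => [|x mx].
  by elim: m {num} => //= i a -> b -> c ->.
by rewrite /tsubop; case: eqP => // eqx; rewrite -eqx mx in num.
Qed.

(** An innermost operation has three letters as arguments. Contracting it to its first letter [u]
    gives [t]. *)
Lemma tmon_split (X : eqType) (m : tmon X) : uniq (tvars m) ->
  (exists x, m = TVar x) \/
  exists t u j v w, [/\ m = tbind (tsubop u j v w) t, u \in tvars t
                      & perm_eq (tvars m) (v :: w :: tvars t)].
Proof.
elim: m => [x _|i a IHa b IHb c IHc]; [by left; exists x|move=> uabc; right].
(* A splitting of one argument extends to the product: [u] does not occur in the other two
   arguments, which the substitution leaves alone. *)
have sub1 q (x y z : tmon X) : uniq (tvars (tins q i x y z)) ->
    (exists t u j v w, [/\ x = tbind (tsubop u j v w) t, u \in tvars t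
                      & perm_eq (tvars x) (v :: w :: tvars t)]) ->
    exists t u j v w, [/\ tins q i x y z = tbind (tsubop u j v w) t, u \in tvars t
                      & perm_eq (tvars (tins q i x y z)) (v :: w :: tvars t)].
  rewrite (perm_uniq (tvars_tins q i x y z)) cat_uniq => /and3P[_ dx _].
  case=> t [u [j [v [w [xE ut px]]]]].
  have notin z' : z' \in tvars y ++ tvars z -> z' \notin tvars x.
    by move=> yz; apply: contra dx => xz; apply/hasP; exists z'.
  have ux : u \in tvars x by rewrite (perm_mem px) !inE ut !orbT.
  exists (tins q i t y z), u, j, v, w; split.
  - by rewrite tbind_tins -xE !tbind_tsubop_id //; apply: contraL ux => uz;
       apply: notin; rewrite mem_cat uz ?orbT.
  - by rewrite (perm_mem (tvars_tins _ _ _ _ _)) mem_cat ut.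
  rewrite (permPl (tvars_tins _ _ _ _ _)) (permPl (perm_cat px (perm_refl _))) /=.
  by rewrite !perm_cons perm_sym tvars_tins.
move: (uabc); rewrite /= !cat_uniq => /and3P[ua _ /and3P[ub _ uc]].
case: (IHa ua) => [[x ax]|sa]; last exact: (sub1 0%N a b c uabc sa).
case: (IHb ub) => [[y by_]|sb]; last exact: (sub1 1%N b a c uabc sb).
case: (IHc uc) => [[z cz]|sc]; last exact: (sub1 2%N c a b uabc sc).
exists (TVar x), x, i, y, z; split; rewrite ?mem_head ?ax ?by_ ?cz //=.
  by rewrite /tsubop eqxx.
by rewrite (perm_catC [:: x] [:: y; z]).
Qed.

Lemma teval_tsub (X Y : choiceType) (V : lmodType F) op (v : Y -> V)
    (s : X -> tmon Y) (f : freeTriple F X) :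
  teval op v (tsub s f) = teval op (fun x => tmon_eval op v (s x)) f.
Proof.
rewrite /teval /tsub linext_comp; apply: eq_in_linext => m _.
by rewrite linext_mon tmon_eval_tbind.
Qed.

Lemma expansion0 (X : choiceType) : expansion (0 : freeTriple F X) = 0.
Proof. exact: linext0. Qed.

Lemma expansionD (X : choiceType) (f g : freeTriple F X) :
  expansion (f + g) = expansion f + expansion g.
Proof. exact: linextD. Qed.

Lemma expansionZ (X : choiceType) c (f : freeTriple F X) :
  expansion (c *: f) = c *: expansion f.
Proof. exact: linextZ. Qed.

Lemma expansion_tsub (X Y : choiceType) (s : X -> tmon Y) (f : freeTriple F X) :
  expansion f = 0 -> expansion (tsub s f) = 0.
Proof. by move/expansion_eq0 => f0; apply/expansion_eq0 => D v; rewrite teval_tsub. Qed.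

Lemma expansion_tins (X : choiceType) q i b c (f : freeTriple F X) :
  expansion f = 0 -> expansion (linext (fun a => mon F (tins q i a b c)) f) = 0.
Proof.
move=> f0; rewrite /expansion /teval linext_comp; set V := freeDend F X.
pose ev := tmon_eval (@prelie_triple F V) (@fdvar F X).
pose h x : V := match q with
  | 0 => prelie_triple i x (ev b) (ev c)
  | 1 => prelie_triple i (ev b) x (ev c)
  | _ => prelie_triple i (ev b) (ev c) x end.
have hl : linear h.
  rewrite /h /prelie_triple; case: q h => [|[|q]] _; case: i => k x y;
    by rewrite ?(prelie_linr, prelie_linl).
transitivity (linext (fun a => h (ev a)) f).
  by apply: eq_in_linext => a _; rewrite linext_mon /h; case: q {h hl} => [|[|q]].
rewrite -linear_linext // [linext _ _]f0.
by rewrite -[X in h X](subrr 0) (linB hl) subrr.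
Qed.

End TripleSubstitution.

(** * Multilinear components of the free triple algebra *)

Section MultilinearPart.
Context (F : fieldType) (X : choiceType).
Implicit Types (A : seq X) (f : freeTriple F X).

Definition mpart A : freeTriple F X -> freeTriple F X :=
  linext (fun m => if perm_eq (tvars m) A then mon F m else 0).

Lemma mpart0 A : mpart A 0 = 0.
Proof. exact: linext0. Qed.

Lemma mpartD A f g : mpart A (f + g) = mpart A f + mpart A g.
Proof. exact: linextD. Qed.

Lemma mpartZ A c f : mpart A (c *: f) = c *: mpart A f.
Proof. exact: linextZ. Qed.

Lemma supported_mpart A f :
  {in msupp (mpart A f), forall m, perm_eq (tvars m) A}.
Proof.
apply: supported_linext => m _; case: ifP => [pm|_]; first exact: supported_mon.
by move=> k; rewrite msupp0 inE.
Qed.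

Lemma mpart_id A f : {in msupp f, forall m, perm_eq (tvars m) A} -> mpart A f = f.
Proof.
move=> sf; rewrite -[RHS]linext_mon_id; apply: eq_in_linext => m /sf.
by move=> ->.
Qed.

Lemma mpart_eq0 A f :
  {in msupp f, forall m, ~~ perm_eq (tvars m) A} -> mpart A f = 0.
Proof.
move=> sf; rewrite /mpart (eq_in_linext (h := fun=> 0)) => [|m /sf /negPf ->//].
by rewrite /linext big1 // => m _; rewrite scaler0.
Qed.

(** The factors [b] and [c] use up the letters [R], which leaves the letters [A'] to [f]. The test
    fails exactly when [R] repeats a letter or leaves [A]. *)
Lemma mpart_tins A q i b c f : uniq A -> let R := tvars b ++ tvars c in
  let A' := [seq x <- A | x \notin R] in
  mpart A (linext (fun a => mon F (tins q i a b c)) f) =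
  if perm_eq (A' ++ R) A then linext (fun a => mon F (tins q i a b c)) (mpart A' f)
  else 0.
Proof.
move=> uA R A'; have pA' s : perm_eq (s ++ R) A -> perm_eq s A'.
  move=> pA; have uR : uniq (s ++ R) by rewrite (perm_uniq pA).
  rewrite /A' -(permPr (perm_filter _ pA)) filter_cat.
  rewrite (_ : [seq x <- R | _] = [::]); last first.
    by apply/eqP; rewrite -size_eq0 size_filter eqn0Ngt -has_count;
       apply/hasPn => x ->.
  rewrite cats0 (_ : [seq x <- s | _] = s) //; apply/all_filterP/allP => x sx.
  apply: contraL uR => Rx; rewrite cat_uniq; apply/negP => /and3P[_ /hasP + _].
  by apply; exists x.
rewrite /mpart !linext_comp; case: ifP => pR.
  apply: eq_in_linext => m _; rewrite linext_mon (permPl (tvars_tins _ _ _ _ _)).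
  have -> : perm_eq (tvars m ++ tvars b ++ tvars c) A = perm_eq (tvars m) A'.
    apply/idP/idP => [/pA'//|pm].
    by rewrite (permPl (perm_cat pm (perm_refl _))).
  by case: ifP => _; rewrite ?linext_mon ?linext0.
rewrite (eq_in_linext (h := fun=> 0)) => [|m _]; last first.
  rewrite linext_mon (permPl (tvars_tins _ _ _ _ _)).
  case: ifP => // /[dup] /pA' pm; rewrite (permPl (perm_cat pm (perm_refl _))).
  by rewrite pR.
by rewrite /linext big1 // => m _; rewrite scaler0.
Qed.

End MultilinearPart.

(** * Spans of liftings, and consequences of the identities of degree at most 5 *)

Section Liftings.
Context (F : fieldType).
Local Notation T7 := (freeTriple F 'I_7).
Implicit Types (A B : seq 'I_7) (f g : T7).

Definition lifted : T7 -> Prop := Sn_span (fun h : T7 =>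
  exists2 f : freeTriple F 'I_5, kerE f & lifting f h).

Lemma lifted_subspace : subspace lifted.
Proof. by split; [exact: Span_zero|exact: Span_add|exact: Span_scale]. Qed.

Lemma TTP n (f : freeTriple F 'I_n) :
  reflect {in msupp f, forall m, perm_eq (tvars m) (enum 'I_n)} (f \in @TT F n).
Proof. exact: allP. Qed.

Lemma perm_enum_ord n (s : seq 'I_n) : uniq s -> size s = n -> perm_eq s (enum 'I_n).
Proof.
move=> us ss; apply: uniq_perm; rewrite ?enum_uniq //.
have [] // := uniq_min_size (s1 := s) (s2 := enum 'I_n) us.
  by move=> x _; rewrite mem_enum.
by rewrite size_enum_ord ss.
Qed.

(* Names [B], [v], [w] as the variables [x_1, .., x_5], [x_6], [x_7]. *)
Lemma kernel_relabel g B v w : size B = 5 -> uniq (v :: w :: B) ->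
  {in msupp g, forall m, perm_eq (tvars m) B} -> expansion g = 0 ->
  exists h (s : 'S_7) (idx : 'I_7 -> 'I_5),
    [/\ kerE h, h = tsub (fun x => TVar (idx x)) g,
        {in B, forall x, s (lshift 2 (idx x)) = x},
        s (rshift 5 (ord0 : 'I_2)) = v & s (rshift 5 (ord_max : 'I_2)) = w].
Proof.
move=> sB uvwB sg g0; pose L := B ++ [:: v; w].
have uL : uniq L by rewrite /L uniq_catC.
have sL : size L = 7 by rewrite size_cat sB.
pose sf (i : 'I_7) := nth v L i.
have sf_inj : injective sf.
  by move=> i j /eqP; rewrite /sf nth_uniq ?sL // => /eqP /val_inj.
(* Outside [B] this is a default value; only letters of [B] occur in [g]. *)
pose idx x : 'I_5 := inord (index x B).
have idxE x : x \in B -> idx x = index x B :> nat.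
  by move=> Bx; rewrite inordK // -[X in (_ < X)%N]sB index_mem.
exists (tsub (fun x => TVar (idx x)) g), (perm sf_inj), idx; split=> //.
- split; last exact: expansion_tsub.
  apply/TTP/supported_tsub => m /sg pm; rewrite tvars_tbind.
  rewrite (_ : flatten _ = map idx (tvars m)); last by elim: (tvars m) => //= x s ->.
  have uB : uniq B by case/and3P: uvwB.
  rewrite (permPl (perm_map _ pm)); apply: perm_enum_ord; last by rewrite size_map.
  rewrite map_inj_in_uniq // => x y Bx By /(congr1 val) /=.
  by rewrite !idxE // => eqi; rewrite -(nth_index v Bx) eqi nth_index.
- by move=> x Bx; rewrite permE /sf /= idxE // nth_cat index_mem Bx nth_index.
- by rewrite permE /sf /= nth_cat sB.
- by rewrite permE /sf /= nth_cat sB.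
Qed.

Lemma permute_varsE n (s : 'S_n) (f : freeTriple F 'I_n) :
  permute_vars s f = tsub (fun x => TVar (s x)) f.
Proof. by apply: tsubst_mon => x; rewrite tvarE. Qed.

Definition lift_subst (i : bool) (k : 'I_5) (l : 'I_5) : tmon 'I_(5 + 2) :=
  if l == k then TOp i (TVar (lshift 2 k)) (TVar (rshift 5 (ord0 : 'I_2)))
                       (TVar (rshift 5 (ord_max : 'I_2)))
  else TVar (lshift 2 l).

Lemma lift_substE (h : freeTriple F 'I_5) i k :
  tsubst (fun j => if j == k then tprod i (tvar F (lshift 2 k))
      (tvar F (rshift 5 (ord0 : 'I_2))) (tvar F (rshift 5 (ord_max : 'I_2)))
    else tvar F (lshift 2 j)) h = tsub (lift_subst i k) h.
Proof.
by apply: tsubst_mon => l; rewrite /lift_subst; case: eqP => _; rewrite !tvarE ?tprod_mon.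
Qed.

Definition lift_prod q i (h : freeTriple F 'I_5) : freeTriple F 'I_(5 + 2) :=
  linext (fun a => mon F (tins q i a (TVar (rshift 5 (ord0 : 'I_2)))
     (TVar (rshift 5 (ord_max : 'I_2))))) (tsub (fun x => TVar (lshift 2 x)) h).

Lemma lift_prodE (h : freeTriple F 'I_5) q i :
  let f := tsubst (fun x => tvar F (lshift 2 x)) h in
  let y := tvar F (rshift 5 (ord0 : 'I_2)) in
  let z := tvar F (rshift 5 (ord_max : 'I_2)) in
  match q with 0 => tprod i f y z | 1 => tprod i y f z | _ => tprod i y z f end
  = lift_prod q i h.
Proof.
move=> f y z; rewrite /lift_prod tins_tprod.
have fE : f = tsub (fun x => TVar (lshift 2 x)) h by apply: tsubst_mon => x; apply: tvarE.
case: q => [|[|q]]; rewrite /=.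
- exact: (f_equal3 (tprod i) fE (tvarE F _) (tvarE F _)).
- exact: (f_equal3 (tprod i) (tvarE F _) fE (tvarE F _)).
- exact: (f_equal3 (tprod i) (tvarE F _) (tvarE F _) fE).
Qed.

Lemma liftingP (h : freeTriple F 'I_5) f : lifting h f <->
  (exists i k, f = tsub (lift_subst i k) h) \/ (exists q i, f = lift_prod q i h).
Proof.
split=> [[i k|i|i|i]|[[i [k ->]]|[q [i ->]]]].
- by left; exists i, k; apply: lift_substE.
- by right; exists 0%N, i; apply: (lift_prodE h 0 i).
- by right; exists 1%N, i; apply: (lift_prodE h 1 i).
- by right; exists 2%N, i; apply: (lift_prodE h 2 i).
- by rewrite -lift_substE; apply: Lift_subst.
- rewrite -lift_prodE; case: q => [|[|q]].
  + exact: Lift_prod1.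
  + exact: Lift_prod2.
  + exact: Lift_prod3.
Qed.

(** The identity is renamed to the standard letters, lifted there, and renamed back by the
    permutation [s]. *)
Lemma lifted_subst g B u v w j : size B = 5 -> uniq (v :: w :: B) -> u \in B ->
  {in msupp g, forall m, perm_eq (tvars m) B} -> expansion g = 0 ->
  lifted (tsub (tsubop u j v w) g).
Proof.
move=> sB uB Bu sg g0;
have [h [s [idx [kh hE sE sv sw]]]] := kernel_relabel sB uB sg g0.
suff -> : tsub (tsubop u j v w) g = permute_vars s (tsub (lift_subst j (idx u)) h).
  by apply/Span_perm/Span_gen; exists h => //; apply/liftingP; left; exists j, (idx u).
rewrite permute_varsE hE !tsub_comp; apply: eq_in_tsub => m /sg pm x.
rewrite (perm_mem pm) => Bx; rewrite /= /tsubop /lift_subst.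
rewrite (_ : (idx x == idx u) = (x == u)); last first.
  by apply/eqP/eqP => [eqi|-> //]; rewrite -(sE x Bx) eqi sE.
by case: eqP => _; rewrite /= ?sE ?sv ?sw.
Qed.

Lemma lifted_prod g B v w q i : size B = 5 -> uniq (v :: w :: B) ->
  {in msupp g, forall m, perm_eq (tvars m) B} -> expansion g = 0 ->
  lifted (linext (fun a => mon F (tins q i a (TVar v) (TVar w))) g).
Proof.
move=> sB uB sg g0;
have [h [s [idx [kh hE sE sv sw]]]] := kernel_relabel sB uB sg g0.
rewrite (_ : linext _ g = permute_vars s (lift_prod q i h)).
  by apply/Span_perm/Span_gen; exists h => //; apply/liftingP; right; exists q, i.
rewrite permute_varsE hE /lift_prod tsub_comp /tsub !linext_comp; apply: eq_in_linext => m /sg pm.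
rewrite !linext_mon tbind_tins /= sv sw tbind_comp; congr (mon _ (tins _ _ _ _ _)).
(* As [v] does not occur in [m], this substitution is trivial; it only makes both sides
   substitutions, to be compared on [B]. *)
rewrite -[LHS](tbind_tsubop_id (u := v) false v w); last first.
  by rewrite (perm_mem pm); case/andP: uB; rewrite inE negb_or => /andP[].
apply: eq_in_tbind => x; rewrite (perm_mem pm) => Bx /=; rewrite sE // /tsubop.
by case: eqP Bx uB => // -> Bv; rewrite /= inE Bv orbT.
Qed.

(* The ideal of the free triple algebra on seven letters generated by the
   identities of degree at most 5, seen through its multilinear components;
   in degree 7 it is required to be spanned by liftings. *)
Definition consequence f := forall A, uniq A ->
  ((size A <= 5)%N -> expansion (mpart A f) = 0) /\ (size A = 7 -> lifted (mpart A f)).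

Lemma consequence_subspace : subspace consequence.
Proof.
have [L0 LD LZ] := lifted_subspace.
split=> [A _|f g Jf Jg A uA|c f Jf A uA].
- by rewrite mpart0 expansion0.
- have [f5 f7] := Jf A uA; have [g5 g7] := Jg A uA.
  rewrite mpartD; split=> sA; last by apply: LD; [apply: f7|apply: g7].
  by rewrite expansionD -[RHS]addr0; congr (_ + _); [apply: f5|apply: g5].
- have [f5 f7] := Jf A uA; rewrite mpartZ; split=> sA; last exact/LZ/f7.
  by rewrite expansionZ f5 // scaler0.
Qed.

Lemma tmon_split2 (X : eqType) (b c : tmon X) : uniq (tvars b ++ tvars c) ->
  (exists v w, b = TVar v /\ c = TVar w) \/
  exists b' c' u j v w, [/\ b = tbind (tsubop u j v w) b',
    c = tbind (tsubop u j v w) c', u \in tvars b' ++ tvars c'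
    & perm_eq (tvars b ++ tvars c) (v :: w :: tvars b' ++ tvars c')].
Proof.
rewrite cat_uniq => /and3P[ub dbc uc].
have notin z : z \in tvars c -> z \notin tvars b.
  by move=> cz; apply: contra dbc => bz; apply/hasP; exists z.
case: (tmon_split ub) => [[v bE]|[t [u [j [v [w [bE tu pb]]]]]]].
  case: (tmon_split uc) => [[w cE]|[t [u [j [v' [w [cE tu pc]]]]]]].
    by left; exists v, w.
  right; exists b, t, u, j, v', w; split=> //.
  - rewrite tbind_tsubop_id //; apply: notin.
    by rewrite (perm_mem pc) !inE tu !orbT.
  - by rewrite mem_cat tu orbT.
  - apply: perm_trans (perm_cat (perm_refl _) pc) _.
    exact/permPl/(perm_catCA _ [:: v'; w]).
right; exists t, c, u, j, v, w; split=> //.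
- rewrite tbind_tsubop_id //; apply/negP => /notin.
  by rewrite (perm_mem pb) !inE tu !orbT.
- by rewrite mem_cat tu.
- by rewrite (permPl (perm_cat pb (perm_refl _))).
Qed.

(** In degree 7 the component of [f] has degree at most 5, since [b] and [c] take at least two
    letters. If both are letters, the product is a lifting. Otherwise an operation inside [b] or [c]
    is contracted: what is left is an identity of degree 5, which a substitution lifts back. *)
Lemma consequence_tins q i b c f :
  consequence f -> consequence (linext (fun a => mon F (tins q i a b c)) f).
Proof.
move=> Jf A uA; rewrite mpart_tins //; set R := tvars b ++ tvars c; set A' := filter _ _.
have [L0 _ _] := lifted_subspace.
case: ifP => [pR|_]; last by rewrite expansion0.
have uR : uniq (A' ++ R) by rewrite (perm_uniq pR).
have sR : (2 <= size R)%N by rewrite size_cat (leq_add (tvars_gt0 b) (tvars_gt0 c)).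
have sA' : (size A' + size R)%N = size A by rewrite -size_cat (perm_size pR).
have uA' : uniq A' by rewrite filter_uniq.
have [f5 _] := Jf A' uA'; split=> sA.
  by apply/expansion_tins/f5; rewrite -sA' in sA; apply: leq_trans sA; rewrite leq_addr.
rewrite sA in sA'; have sA5 : (size A' <= 5)%N.
  by rewrite -(leq_add2r 2) -[(5 + 2)%N]sA' leq_add2l.
have g0 := f5 sA5; have sg := @supported_mpart F _ A' f.
set g := mpart A' f in g0 sg *.
have ubc : uniq R by move: uR; rewrite cat_uniq => /and3P[].
have [[v [w [bE cE]]]|[b' [c' [u [j [v [w [bE cE ut pR']]]]]]]] := tmon_split2 ubc.
  rewrite /R bE cE in sA' uR *; apply: (lifted_prod _ _ _ _ sg g0).
    by apply: (@addIn 2); exact: sA'.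
  by rewrite -[_ :: _]/([:: v; w] ++ A') uniq_catC.
pose B := A' ++ tvars b' ++ tvars c'.
have pB : perm_eq (A' ++ R) (v :: w :: B).
  apply: (@perm_trans _ (A' ++ [:: v; w] ++ tvars b' ++ tvars c')).
    by rewrite perm_cat2l.
  exact/permPl/(perm_catCA _ [:: v; w]).
have uvwB : uniq (v :: w :: B) by rewrite -(perm_uniq pB).
have sB : size B = 5.
  by apply: (@addnI 2); rewrite -[LHS](perm_size pB) size_cat sA'.
have uA'' : u \notin A'.
  have uB : uniq B by case/and3P: uvwB.
  move: uB; rewrite cat_uniq => /and3P[_ dA' _].
  by apply: contra dA' => A'u; apply/hasP; exists u.
have -> : linext (fun a => mon F (tins q i a b c)) g = tsub (tsubop u j v w)
    (linext (fun a => mon F (tins q i a b' c')) g).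
  rewrite /tsub linext_comp; apply: eq_in_linext => m /sg pm.
  by rewrite linext_mon tbind_tins -bE -cE tbind_tsubop_id // (perm_mem pm).
apply: (lifted_subst _ sB uvwB).
- by rewrite mem_cat ut orbT.
- apply: supported_linext => m /sg pm; apply: supported_mon.
  by rewrite (permPl (tvars_tins _ _ _ _ _)) perm_cat2r.
- by apply: expansion_tins; apply: g0.
Qed.

(** All monomials of the instance have the letters [L s], so its component in [A] is everything or
    zero. In degree 7 an operation inside one of the substituted monomials is contracted, and the
    instance is a lifting of an instance of degree 5. *)
Lemma consequence_tsub n (h : freeTriple F 'I_n) (s : 'I_n -> tmon 'I_7) :
  (n <= 5)%N -> kerE h -> consequence (tsub s h).
Proof.
move=> n5 [/TTP sh h0] A uA; pose L (s : 'I_n -> tmon 'I_7) :=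
  flatten [seq tvars (s x) | x <- enum 'I_n].
have [L0 _ _] := lifted_subspace.
have ssub s' : {in msupp (tsub s' h), forall m, perm_eq (tvars m) (L s')}.
  apply: supported_tsub => m /sh pm; rewrite tvars_tbind.
  exact/perm_flatten/perm_map.
have [pLA|npLA] := boolP (perm_eq (L s) A); last first.
  by rewrite mpart_eq0 ?expansion0 // => m /ssub pm; rewrite (permPl pm).
rewrite mpart_id; last by move=> m /ssub pm; rewrite (permPl pm).
split=> sA; first exact: expansion_tsub.
have uL : uniq (L s) by rewrite (perm_uniq pLA).
pose isvar (m : tmon 'I_7) := if m is TVar _ then true else false.
(* If only letters were substituted, the degree would be [n], which is not 7. *)
have [x nvx|allvar] := pickP (fun x => ~~ isvar (s x)); last first.
  have := perm_size pLA; rewrite sA /L size_flatten /shape -map_comp.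
  rewrite (eq_map (g := fun=> 1%N)) => [|x /=]; last first.
    by have := allvar x; case: (s x).
  rewrite sumnE big_map big_const_seq count_predT size_enum_ord iter_addn_0 mul1n.
  by move=> n7; rewrite n7 in n5.
have [rest enumE] : exists rest, perm_eq (enum 'I_n) (x :: rest).
  by exists (rem x (enum 'I_n)); apply: perm_to_rem; rewrite mem_enum.
have LE s' : perm_eq (L s') (tvars (s' x) ++ flatten [seq tvars (s' y) | y <- rest]).
  by apply: (perm_trans (perm_flatten (perm_map _ enumE))).
have xrest : x \notin rest.
  by have := enum_uniq 'I_n; rewrite (perm_uniq enumE) => /andP[].
have usx : uniq (tvars (s x)).
  by move: uL; rewrite (perm_uniq (LE s)) cat_uniq => /and3P[].
have [[y sxE]|[t [u [j [v [w [sxE tu psx]]]]]]] := tmon_split usx.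
  by rewrite sxE in nvx.
pose s' y := if y == x then t else s y.
have restE : flatten [seq tvars (s' y) | y <- rest] = flatten [seq tvars (s y) | y <- rest].
  congr flatten; apply/eq_in_map => y ry; rewrite /s'; case: eqP => // eqx.
  by rewrite -eqx ry in xrest.
have pL : perm_eq (L s) (v :: w :: L s').
  rewrite (permPl (LE s)) (permPl (perm_cat psx (perm_refl _))) /= !perm_cons.
  by rewrite -restE perm_sym (permPl (LE s')) /s' eqxx.
have uvwL : uniq (v :: w :: L s') by rewrite -(perm_uniq pL).
have su y : y != x -> u \notin tvars (s y).
  move=> neq; move: uL; rewrite (perm_uniq (LE s)) cat_uniq => /and3P[_ + _].
  apply: contra => syu; apply/hasP; exists u; last first.
    by rewrite /= (perm_mem psx) !inE tu !orbT.
  apply/flatten_mapP; exists y => //.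
  by have := mem_enum 'I_n y; rewrite (perm_mem enumE) inE (negPf neq).
have -> : tsub s h = tsub (tsubop u j v w) (tsub s' h).
  rewrite tsub_comp; apply: eq_in_tsub => m _ y _; rewrite /s'.
  by case: eqP => [->|/eqP /su /tbind_tsubop_id ->].
apply: (lifted_subst _ _ uvwL).
- by apply: (@addnI 2); rewrite -[LHS](perm_size pL) (perm_size pLA) sA.
- by rewrite (perm_mem (LE s')) mem_cat /s' eqxx tu.
- exact: ssub.
- by apply: expansion_tsub; apply: h0.
Qed.

End Liftings.

(** * The graded pre-Lie algebra of a triple algebra *)

(* The odd part of a Z/2-graded pre-Lie algebra is a triple algebra; here the
   graded algebra is recovered from its odd part.  [inl u] is odd and
   [inr (u, w)] is the product of the odd elements [u] and [w]. *)
Definition hmon (X : Type) := (tmon X + tmon X * tmon X)%type.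
HB.instance Definition _ (X : choiceType) := Choice.on (hmon X).

Definition hodd (F : fieldType) (X : choiceType) (u : tmon X) : {malg F[hmon X]} :=
  mon F (inl u : hmon X).
Definition heven (F : fieldType) (X : choiceType) (u w : tmon X) : {malg F[hmon X]} :=
  mon F (inr (u, w) : hmon X).

(* The last case is forced by [(u w) y = (u y) w + u (w y) - u (y w)]. *)
Definition hmon_mul (F : fieldType) (X : choiceType) (e e' : hmon X) :
    {malg F[hmon X]} :=
  match e, e' with
  | inl u, inl w => heven F u w
  | inr (u, w), inl z => hodd F (TOp false u w z)
  | inl z, inr (u, w) => hodd F (TOp true z u w)
  | inr (u, w), inr (a, b) =>
      heven F (TOp true u a b) w + heven F u (TOp true w a b)
      - heven F u (TOp false a b w)
  end.

HB.lock Definition hmul (F : fieldType) (X : choiceType) (f g : {malg F[hmon X]}) :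
  {malg F[hmon X]} := linext (fun e => linext (hmon_mul F e) g) f.
Arguments hmul {F X} f g.

HB.lock Definition hrel (F : fieldType) (X : choiceType) (x y z : {malg F[hmon X]}) :
    {malg F[hmon X]} :=
  hmul (hmul x y) z - hmul x (hmul y z) - (hmul (hmul x z) y - hmul x (hmul z y)).
Arguments hrel {F X} x y z.

Section HalfProducts.
Context (F : fieldType) (X : choiceType).
Local Notation H := {malg F[hmon X]}.
Implicit Types (e : hmon X) (f g h x y z : H) (a b c u w : tmon X).

Lemma hmul_linl g : linear (hmul^~ g).
Proof. by move=> c f f'; rewrite hmul.unlock linext_is_linear. Qed.

Lemma hmul_linr f : linear (hmul f).
Proof.
move=> c g g'; rewrite hmul.unlock /linext scaler_sumr -big_split /=.
apply: eq_bigr => e _; rewrite -!/(linext _ _) linext_is_linear scalerDr !scalerA.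
by rewrite mulrC.
Qed.

Lemma hmulDl f f' g : hmul (f + f') g = hmul f g + hmul f' g.
Proof. by rewrite -[f in LHS]scale1r hmul_linl scale1r. Qed.
Lemma hmulBl f f' g : hmul (f - f') g = hmul f g - hmul f' g.
Proof. exact: (linB (hmul_linl g)). Qed.
Lemma hmulDr f g g' : hmul f (g + g') = hmul f g + hmul f g'.
Proof. by rewrite -[g in LHS]scale1r hmul_linr scale1r. Qed.
Lemma hmulBr f g g' : hmul f (g - g') = hmul f g - hmul f g'.
Proof. exact: (linB (hmul_linr f)). Qed.
Lemma hmul0l g : hmul 0 g = 0.
Proof. by rewrite -[X in hmul X _](subrr 0) hmulBl subrr. Qed.
Lemma hmul0r f : hmul f 0 = 0.
Proof. by rewrite -[X in hmul _ X](subrr 0) hmulBr subrr. Qed.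
Lemma hmulZl (c : F) f g : hmul (c *: f) g = c *: hmul f g.
Proof. by rewrite -[c *: f]addr0 hmul_linl hmul0l addr0. Qed.
Lemma hmulZr (c : F) f g : hmul f (c *: g) = c *: hmul f g.
Proof. by rewrite -[c *: g]addr0 hmul_linr hmul0r addr0. Qed.
Lemma hmulNl f g : hmul (- f) g = - hmul f g.
Proof. by rewrite -!scaleN1r hmulZl. Qed.
Lemma hmulNr f g : hmul f (- g) = - hmul f g.
Proof. by rewrite -!scaleN1r hmulZr. Qed.
Definition hmulE := (hmulBl, hmulBr, hmulDl, hmulDr, hmulZl, hmulZr, hmulNl, hmulNr).

Lemma hmul_mon e e' : hmul (mon F e) (mon F e') = hmon_mul F e e'.
Proof. by rewrite hmul.unlock !linext_mon. Qed.

Lemma hmul_oo a b : hmul (hodd F a) (hodd F b) = heven F a b.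
Proof. exact: hmul_mon. Qed.
Lemma hmul_oe a b c : hmul (hodd F a) (heven F b c) = hodd F (TOp true a b c).
Proof. exact: hmul_mon. Qed.
Lemma hmul_eo a b c : hmul (heven F a b) (hodd F c) = hodd F (TOp false a b c).
Proof. exact: hmul_mon. Qed.

Lemma hmul_linextl (K : choiceType) (k : K -> H) (f : {malg F[K]}) g :
  hmul (linext k f) g = linext (fun i => hmul (k i) g) f.
Proof. exact: (linear_linext _ _ (hmul_linl g)). Qed.
Lemma hmul_linextr (K : choiceType) (k : K -> H) f (g : {malg F[K]}) :
  hmul f (linext k g) = linext (fun i => hmul f (k i)) g.
Proof. exact: (linear_linext _ _ (hmul_linr f)). Qed.

Lemma hrel_lin1 y z : linear (fun x => hrel x y z).
Proof.
move=> c x x'; rewrite hrel.unlock !hmulE; apply/malgP => k.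
by rewrite !(mcoeffD, mcoeffN, mcoeffZ); ring.
Qed.
Lemma hrel_lin2 x z : linear (fun y => hrel x y z).
Proof.
move=> c y y'; rewrite hrel.unlock !hmulE; apply/malgP => k.
by rewrite !(mcoeffD, mcoeffN, mcoeffZ); ring.
Qed.
Lemma hrel_lin3 x y : linear (hrel x y).
Proof.
move=> c z z'; rewrite hrel.unlock !hmulE; apply/malgP => k.
by rewrite !(mcoeffD, mcoeffN, mcoeffZ); ring.
Qed.

Lemma hrelC x y z : hrel x z y = - hrel x y z.
Proof. by rewrite hrel.unlock [RHS]opprB. Qed.

Definition is_even e := if e is inr _ then true else false.

(** This is the equation by which the product of two even elements was defined. *)
Lemma hrel_ooe a b f : {in msupp f, forall e, is_even e} ->
  hrel (hodd F a) (hodd F b) f = 0.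
Proof.
move=> sf; rewrite -[f]linext_mon_id (linear_linext _ _ (hrel_lin3 _ _)).
rewrite (eq_in_linext (h := fun=> 0)) => [|e /sf].
  by rewrite /linext big1 // => e _; rewrite scaler0.
case: e => // -[p q] _; rewrite -[mon F _]/(heven F p q) hrel.unlock.
rewrite hmul_oo !hmul_oe !hmul_oo [hmul (heven _ _ _) (heven _ _ _)]hmul_mon /=.
rewrite hmul_eo hmul_oo; apply/malgP => k.
by rewrite !(mcoeffD, mcoeffN, mcoeff0); ring.
Qed.

(** A formal identity for any bilinear product. On the right-hand side relations are multiplied on
    the right by [y] and [z] only, which will be odd while [t] is even. *)
Lemma hmul_relr x y z t : hmul (hrel x y z) t =
  hrel (hmul x y) z t + hmul (hrel x y t) z
  - hrel (hmul x z) y t - hmul (hrel x z t) y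
  - hrel x (hmul y z) t + hrel x (hmul z y) t
  + hrel (hmul x t) y z + hrel x (hmul y t - hmul t y) z
  + hrel x y (hmul z t - hmul t z)
  - hmul x (hrel y z t + hrel z t y + hrel t y z).
Proof.
rewrite hrel.unlock !hmulE; apply/malgP => k.
by rewrite !(mcoeffD, mcoeffN); ring.
Qed.

(** Again formal. For [a], [b] odd and [y], [z] even, every relation in the last two brackets has
    type odd, odd, even and vanishes by [hrel_ooe]. *)
Lemma hrel_mull (a b y z : H) : hrel (hmul a b) y z =
  hmul (hrel a y z) b + hmul a (hrel b y z + hrel y z b + hrel z b y)
  + (hmul (hrel a b y) z + hrel a (hmul b y) z + hrel (hmul a y) b z
     - hrel a (hmul y b) z - hrel a b (hmul y z))
  - (hmul (hrel a b z) y + hrel a (hmul b z) y + hrel (hmul a z) b y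
     - hrel a (hmul z b) y - hrel a b (hmul z y)).
Proof.
rewrite hrel.unlock !hmulE; apply/malgP => k.
by rewrite !(mcoeffD, mcoeffN); ring.
Qed.

End HalfProducts.

(** * Morphisms, letters and parity in the graded algebra *)

Section HalfProductMorphisms.
Context (F : fieldType).

Definition hev (X : choiceType) (D : dendType F) (v : X -> D) (e : hmon X) : D :=
  let ev := tmon_eval (@prelie_triple F D) v in
  match e with inl u => ev u | inr (u, w) => prelie (ev u) (ev w) end.

Definition hmap (X Y : choiceType) (s : X -> tmon Y) (e : hmon X) : {malg F[hmon Y]} :=
  match e with
  | inl u => hodd F (tbind s u)
  | inr (u, w) => heven F (tbind s u) (tbind s w)
  end.

Lemma linext_bilinear (X : choiceType) (V : lmodType F) (mul : V -> V -> V)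
    (phi : hmon X -> V) (f g : {malg F[hmon X]}) :
  (forall y, linear (mul^~ y)) -> (forall x, linear (mul x)) ->
  (forall e e', linext phi (hmon_mul F e e') = mul (phi e) (phi e')) ->
  linext phi (hmul f g) = mul (linext phi f) (linext phi g).
Proof.
move=> ml mr mE; rewrite hmul.unlock linext_comp (linear_linext _ _ (ml _)).
apply: eq_in_linext => e _; rewrite linext_comp (linear_linext _ _ (mr _)).
by apply: eq_in_linext => e' _; apply: mE.
Qed.

Lemma linext_hmap_mul (X Y : choiceType) (s : X -> tmon Y) (f g : {malg F[hmon X]}) :
  linext (hmap s) (hmul f g) = hmul (linext (hmap s) f) (linext (hmap s) g).
Proof.
apply: linext_bilinear; [exact: hmul_linl|exact: hmul_linr|].
case=> [u|[u w]] [z|[a b]]; rewrite /= ?linextB ?linextD !linext_mon /=.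
- by rewrite hmul_oo.
- by rewrite hmul_oe.
- by rewrite hmul_eo.
- by rewrite [RHS]hmul_mon.
Qed.

(** On two even elements this is [prelie_rel] in [D], solved for the product. *)
Lemma linext_hev_mul (X : choiceType) (D : dendType F) (v : X -> D) f g :
  linext (hev v) (hmul f g) = prelie (linext (hev v) f) (linext (hev v) g).
Proof.
apply: linext_bilinear; [exact: prelie_linl|exact: prelie_linr|].
case=> [u|[u w]] [z|[a b]]; rewrite /= ?linextB ?linextD !linext_mon //=.
set U := tmon_eval _ _ u; set W := tmon_eval _ _ w.
set Y := prelie (tmon_eval _ _ a) (tmon_eval _ _ b).
have /eqP := prelie_rel U W Y; rewrite subr_eq0 subr_eq => /eqP ->.
by rewrite addrAC.
Qed.

Context (X : choiceType).
Implicit Types (f g : {malg F[hmon X]}) (e : hmon X).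

Definition hpart : {malg F[hmon X]} -> freeTriple F X :=
  linext (fun e => if e is inl u then mon F u else 0).

Definition hincl : freeTriple F X -> {malg F[hmon X]} := linext (hodd F (X := X)).

Lemma hpart_hincl (f : freeTriple F X) : hpart (hincl f) = f.
Proof.
rewrite /hpart linext_comp -[RHS]linext_mon_id.
by apply: eq_in_linext => m _; rewrite linext_mon.
Qed.

Lemma hincl_hpart f : {in msupp f, forall e, ~~ is_even e} -> hincl (hpart f) = f.
Proof.
move=> sf; rewrite /hincl linext_comp -[RHS]linext_mon_id.
by apply: eq_in_linext => -[u|[u w]] /sf // _; rewrite linext_mon.
Qed.

Lemma hpart_even f : {in msupp f, forall e, is_even e} -> hpart f = 0.
Proof.
move=> sf; rewrite /hpart (eq_in_linext (h := fun=> 0)) => [|[u|[u w]] /sf //].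
by rewrite /linext big1 // => e _; rewrite scaler0.
Qed.

Definition hvars e : seq X :=
  match e with inl u => tvars u | inr (u, w) => tvars u ++ tvars w end.

Lemma size_hvars e : odd (size (hvars e)) = ~~ is_even e.
Proof. by case: e => [u|[u w]]; rewrite /= ?size_cat ?oddD !size_tvars. Qed.

Lemma supported_hmon_mul e e' : {in msupp (hmon_mul F e e'),
  forall e'', perm_eq (hvars e'') (hvars e ++ hvars e')}.
Proof.
case: e e' => [u|[u w]] [z|[a b]] /=.
- exact: supported_mon.
- exact: supported_mon.
- by apply: supported_mon; rewrite /= catA.
have [_ sD _] := supported_subspace F (fun e : hmon X =>
  perm_eq (hvars e) ((tvars u ++ tvars w) ++ tvars a ++ tvars b)).
apply: (subspaceB (supported_subspace F (fun e : hmon X =>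
  perm_eq (hvars e) ((tvars u ++ tvars w) ++ tvars a ++ tvars b)))).
  apply: sD; apply: supported_mon; rewrite /= -!catA perm_cat2l //.
  by rewrite catA perm_catC.
by apply: supported_mon; rewrite /= -!catA perm_cat2l catA perm_catC.
Qed.

Lemma supported_hmul A B f g :
  {in msupp f, forall e, perm_eq (hvars e) A} ->
  {in msupp g, forall e, perm_eq (hvars e) B} ->
  {in msupp (hmul f g), forall e, perm_eq (hvars e) (A ++ B)}.
Proof.
move=> sf sg; rewrite hmul.unlock; apply: supported_linext => e /sf pe.
apply: supported_linext => e' /sg pe' e'' /supported_hmon_mul.
by move/perm_trans; apply; apply: perm_cat.
Qed.

Lemma even_hmul (p q : bool) f g :
  {in msupp f, forall e, is_even e == p} -> {in msupp g, forall e, is_even e == q} ->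
  {in msupp (hmul f g), forall e, is_even e == (p == q)}.
Proof.
move=> sf sg; rewrite hmul.unlock; apply: supported_linext => e /sf /eqP <-.
apply: supported_linext => e' /sg /eqP <- e'' /supported_hmon_mul /perm_size.
move/(congr1 odd); rewrite size_cat oddD !size_hvars.
by case: (is_even e); case: (is_even e'); case: (is_even e'').
Qed.

(** Variables take odd values, so the parity of a value is that of the number of variables. *)
Definition rho (Z : Type) (s : Z -> tmon X) : bmon Z -> {malg F[hmon X]} :=
  beval (@hmul F X) (fun x => hodd F (s x)).

Lemma supported_rho (Z : choiceType) (s : Z -> tmon X) m :
  {in msupp (rho s m), forall e,
    perm_eq (hvars e) (flatten [seq tvars (s x) | x <- bvars m])}.
Proof.
elim: m => [x|a IHa b IHb] /=; first by apply: supported_mon; rewrite /= cats0.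
by rewrite map_cat flatten_cat; apply: supported_hmul.
Qed.

End HalfProductMorphisms.

(** * The graded ideal, its closure under products, and the pre-Lie relations in it *)

Section GradedIdeal.
Context (F : fieldType).
Local Notation H := {malg F[hmon 'I_7]}.
Implicit Types (f g : H) (a b c u w y z p q : tmon 'I_7).

(** At the variables themselves the value of [t] is odd and vanishes in every dendriform dialgebra,
    so it is an identity of degree [n] of the triple products. The value at [s] is a substitution
    instance of it. *)
Lemma consequence_prelie n (t : {malg F[bmon 'I_n]}) (s : 'I_n -> tmon 'I_7) :
  (n <= 5)%N -> odd n -> {in msupp t, forall m, perm_eq (bvars m) (enum 'I_n)} ->
  prelie_ideal t ->
  exists2 f, consequence f & linext (rho F s) t = hincl f.
Proof.
move=> n5 on st It; pose g := linext (rho F (@TVar 'I_n)) t.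
have sg : {in msupp g, forall e, perm_eq (hvars e) (enum 'I_n)}.
  apply: supported_linext => m /st pm e /supported_rho.
  rewrite (_ : flatten _ = bvars m); last by elim: (bvars m) => //= x l ->.
  by move=> pe; rewrite (permPl pe).
have og : {in msupp g, forall e, ~~ is_even e}.
  by move=> e /sg pe; rewrite -size_hvars (perm_size pe) size_enum_ord.
have kg : kerE (hpart g).
  split.
    apply/TTP; apply: supported_linext => -[u|[u w]] /sg pe.
      exact: supported_mon.
    by move=> m; rewrite msupp0 inE.
  apply/expansion_eq0 => D v; rewrite /teval linext_comp.
  transitivity (linext (hev v) g).
    by apply: eq_in_linext => -[u|[u w]] /og // _; rewrite linext_mon.
  rewrite linext_comp -(prelie_ideal_eval0 v It); apply: eq_in_linext => m _.
  elim: m => [x|a IHa b IHb] /=; first by rewrite linext_mon.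
  by rewrite linext_hev_mul IHa IHb.
exists (tsub s (hpart g)); first exact: consequence_tsub.
transitivity (linext (hmap F s) g).
  rewrite linext_comp; apply: eq_in_linext => m _.
  elim: m => [x|a IHa b IHb]; first by rewrite linext_mon.
  by rewrite [rho _ _ _]/= linext_hmap_mul -IHa -IHb.
rewrite -[in LHS](hincl_hpart og) /hincl linext_comp /tsub linext_comp.
by apply: eq_in_linext => m _; rewrite !linext_mon.
Qed.

(** The quotient by it is V + V (x) V / R: consequences are killed in the odd part and in either
    tensor factor, and [GI_rel] spans R. That it is an ideal containing all pre-Lie relations is
    proved below. *)
Inductive graded_ideal : H -> Prop :=
  | GI_odd (f : freeTriple F 'I_7) : consequence f -> graded_ideal (hincl f)
  | GI_left (f : freeTriple F 'I_7) w :
      consequence f -> graded_ideal (linext (fun u => heven F u w) f)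
  | GI_right (f : freeTriple F 'I_7) u :
      consequence f -> graded_ideal (linext (fun w => heven F u w) f)
  | GI_rel a b y z : graded_ideal (hrel (heven F a b) (hodd F y) (hodd F z))
  | GI_zero : graded_ideal 0
  | GI_add f g : graded_ideal f -> graded_ideal g -> graded_ideal (f + g)
  | GI_scale (c : F) f : graded_ideal f -> graded_ideal (c *: f).

Lemma graded_ideal_subspace : subspace graded_ideal.
Proof. by split; [exact: GI_zero|exact: GI_add|exact: GI_scale]. Qed.

Lemma GI_sub f g : graded_ideal f -> graded_ideal g -> graded_ideal (f - g).
Proof. exact: subspaceB graded_ideal_subspace. Qed.

Lemma GI_opp f : graded_ideal f -> graded_ideal (- f).
Proof. by move=> If; rewrite -sub0r; apply: GI_sub => //; apply: GI_zero. Qed.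

Lemma GI_prelie n (t : {malg F[bmon 'I_n]}) (s : 'I_n -> tmon 'I_7) :
  (n <= 5)%N -> odd n -> {in msupp t, forall m, perm_eq (bvars m) (enum 'I_n)} ->
  prelie_ideal t -> graded_ideal (linext (rho F s) t).
Proof.
by move=> n5 on st It; have [f Jf ->] := consequence_prelie s n5 on st It; apply: GI_odd.
Qed.

Lemma supported_brel (X : choiceType) (a b c : bmon X) :
  {in msupp (brel F a b c), forall m,
     perm_eq (bvars m) (bvars a ++ bvars b ++ bvars c)}.
Proof.
pose S := supported_subspace F (fun m : bmon X =>
  perm_eq (bvars m) (bvars a ++ bvars b ++ bvars c)).
apply: (subspaceB S); apply: (subspaceB S); apply: supported_mon; rewrite /= -?catA //.
  by rewrite perm_cat2l perm_catC.
by rewrite perm_cat2l perm_catC.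
Qed.

Lemma rho_brel (X Z : choiceType) (s : Z -> tmon X) (a b c : bmon Z) :
  linext (rho F s) (brel F a b c) = hrel (rho F s a) (rho F s b) (rho F s c).
Proof. by rewrite hrel.unlock /brel !linextB !linext_mon. Qed.

Let x3 (i : nat) : bmon 'I_3 := BVar (inord i).
Let x5 (i : nat) : bmon 'I_5 := BVar (inord i).

Lemma uniq_inord n : uniq [seq inord i : 'I_n.+1 | i <- iota 0 n.+1].
Proof.
rewrite map_inj_in_uniq ?iota_uniq // => i j; rewrite !mem_iota => /= lti ltj.
by move/(congr1 val); rewrite /= !inordK.
Qed.

Lemma perm_inord n : perm_eq [seq inord i : 'I_n.+1 | i <- iota 0 n.+1] (enum 'I_n.+1).
Proof. by apply: perm_enum_ord; rewrite ?uniq_inord // size_map size_iota. Qed.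

Lemma GI_ooo a b c : graded_ideal (hrel (hodd F a) (hodd F b) (hodd F c)).
Proof.
(* The default [a] of [nth] is never reached. *)
have := @GI_prelie 3 (brel F (x3 0) (x3 1) (x3 2)) (fun i => nth a [:: a; b; c] i).
rewrite rho_brel /rho /= !inordK //=; apply=> //; last exact: PI_rel.
by move=> m /supported_brel pm; rewrite (permPl pm); apply: (perm_inord 2).
Qed.

Lemma GI_brel5 (i j k : bmon 'I_5) (s : 'I_5 -> tmon 'I_7) :
  bvars i ++ bvars j ++ bvars k = [seq inord i | i <- iota 0 5] ->
  graded_ideal (hrel (rho F s i) (rho F s j) (rho F s k)).
Proof.
move=> ijk; rewrite -rho_brel; apply: GI_prelie => //; last exact: PI_rel.
by move=> m /supported_brel pm; rewrite (permPl pm) ijk (perm_inord 4).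
Qed.

Lemma GI_oee a b c p q :
  graded_ideal (hrel (hodd F a) (heven F b c) (heven F p q)).
Proof.
have := @GI_brel5 (x5 0) (BMul (x5 1) (x5 2)) (BMul (x5 3) (x5 4))
  (fun i => nth a [:: a; b; c; p; q] i) erefl.
by rewrite /rho /= !inordK //= !hmul_oo.
Qed.

Lemma GI_eoe a b c p q :
  graded_ideal (hrel (heven F a b) (hodd F c) (heven F p q)).
Proof.
have := @GI_brel5 (BMul (x5 0) (x5 1)) (x5 2) (BMul (x5 3) (x5 4))
  (fun i => nth a [:: a; b; c; p; q] i) erefl.
by rewrite /rho /= !inordK //= !hmul_oo.
Qed.

Lemma hrel_eoo_rho (s : 'I_5 -> tmon 'I_7) :
  linext (rho F s) (brel F (BMul (x5 0) (x5 1)) (x5 2) (x5 3)) =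
  hrel (heven F (s (inord 0)) (s (inord 1)))
    (hodd F (s (inord 2))) (hodd F (s (inord 3))).
Proof. by rewrite rho_brel /rho /= hmul_oo. Qed.

(** The product of a generator of R with an odd element comes from a pre-Lie consequence in five
    variables; the other generators give products with a consequence. *)
Lemma GI_mulr_odd f c : graded_ideal f -> graded_ideal (hmul f (hodd F c)).
Proof.
elim=> {f}.
- move=> f Jf; rewrite hmul_linextl.
  rewrite (eq_in_linext (h := fun u => heven F u c)) => [|u _]; last exact: hmul_oo.
  exact: GI_left.
- move=> f w Jf; rewrite hmul_linextl.
  have := GI_odd (consequence_tins 0 false w c Jf).
  rewrite /hincl linext_comp; congr graded_ideal; apply: eq_in_linext => u _.
  by rewrite linext_mon hmul_eo.
- move=> f w Jf; rewrite hmul_linextl.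
  have := GI_odd (consequence_tins 1 false w c Jf).
  rewrite /hincl linext_comp; congr graded_ideal; apply: eq_in_linext => u _.
  by rewrite linext_mon hmul_eo.
- move=> a b y z; pose s (i : 'I_5) := nth a [:: a; b; y; z; c] i.
  have := @GI_prelie 5 (bmulr (x5 4) (brel F (BMul (x5 0) (x5 1)) (x5 2) (x5 3))) s.
  rewrite /bmulr linext_comp (eq_in_linext (h := fun m =>
    hmul (rho F s m) (hodd F c))) => [|m _]; last first.
    by rewrite linext_mon /rho /= /s inordK.
  rewrite -hmul_linextl hrel_eoo_rho /s !inordK //=; apply=> //.
    apply: supported_linext => m /supported_brel pm; apply: supported_mon.
    by rewrite /= (permPl (perm_cat pm (perm_refl _))) (perm_inord 4).
  exact/PI_mulr/PI_rel.
- by rewrite hmul0l; apply: GI_zero.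
- by move=> f g _ If _ Ig; rewrite hmulDl; apply: GI_add.
- by move=> k f _ If; rewrite hmulZl; apply: GI_scale.
Qed.

Lemma GI_mull_odd f c : graded_ideal f -> graded_ideal (hmul (hodd F c) f).
Proof.
elim=> {f}.
- move=> f Jf; rewrite hmul_linextr.
  rewrite (eq_in_linext (h := fun u => heven F c u)) => [|u _]; last exact: hmul_oo.
  exact: GI_right.
- move=> f w Jf; rewrite hmul_linextr.
  have := GI_odd (consequence_tins 1 true c w Jf).
  rewrite /hincl linext_comp; congr graded_ideal; apply: eq_in_linext => u _.
  by rewrite linext_mon hmul_oe.
- move=> f w Jf; rewrite hmul_linextr.
  have := GI_odd (consequence_tins 2 true c w Jf).
  rewrite /hincl linext_comp; congr graded_ideal; apply: eq_in_linext => u _.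
  by rewrite linext_mon hmul_oe.
- move=> a b y z; pose s (i : 'I_5) := nth a [:: a; b; y; z; c] i.
  have := @GI_prelie 5 (bmull (x5 4) (brel F (BMul (x5 0) (x5 1)) (x5 2) (x5 3))) s.
  rewrite /bmull linext_comp (eq_in_linext (h := fun m =>
    hmul (hodd F c) (rho F s m))) => [|m _]; last first.
    by rewrite linext_mon /rho /= /s inordK.
  rewrite -hmul_linextr hrel_eoo_rho /s !inordK //=; apply=> //.
    apply: supported_linext => m /supported_brel pm; apply: supported_mon.
    rewrite -(permPr (perm_inord 4)).
    rewrite -[bvars _]/([:: inord 4] ++ bvars m) (permPl (perm_cat (perm_refl _) pm)).
    by rewrite perm_catC.
  exact/PI_mull/PI_rel.
- by rewrite hmul0r; apply: GI_zero.
- by move=> f g _ If _ Ig; rewrite hmulDr; apply: GI_add.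
- by move=> k f _ If; rewrite hmulZr; apply: GI_scale.
Qed.

Lemma even_heven a b : {in msupp (heven F a b), forall e, is_even e == true}.
Proof. exact: supported_mon. Qed.

Lemma even_hodd a : {in msupp (hodd F a), forall e, is_even e == false}.
Proof. exact: supported_mon. Qed.

Lemma even_hrel a b y z :
  {in msupp (hrel (heven F a b) (hodd F y) (hodd F z)), forall e, is_even e}.
Proof.
have e2 u w : {in msupp (hmul (hodd F u) (hodd F w)), forall e, is_even e == true}.
  exact: even_hmul (@even_hodd u) (@even_hodd w).
have e1 u : {in msupp (hmul (heven F a b) (hodd F u)), forall e, is_even e == false}.
  exact: even_hmul (@even_heven a b) (@even_hodd u).
have S := supported_subspace F (fun e : hmon 'I_7 => is_even e == true).
suff h : {in msupp (hrel (heven F a b) (hodd F y) (hodd F z)),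
    forall e, is_even e == true} by move=> e /h /eqP.
rewrite hrel.unlock; apply: (subspaceB S); apply: (subspaceB S).
- exact: even_hmul (e1 _) (@even_hodd _).
- exact: even_hmul (@even_heven _ _) (e2 _ _).
- exact: even_hmul (e1 _) (@even_hodd _).
- exact: even_hmul (@even_heven _ _) (e2 _ _).
Qed.

Lemma GI_mull_even f a b : graded_ideal f -> graded_ideal (hmul (heven F a b) f).
Proof.
have evenC g : {in msupp g, forall e, is_even e} -> graded_ideal g ->
    graded_ideal (hmul (heven F a b) g).
  (* For [g] even, (a b) g = (a g) b - a (g b) + a (b g) needs only products with odd elements. *)
  move=> /(hrel_ooe a b) /eqP; rewrite hrel.unlock hmul_oo subr_eq0 subr_eq => /eqP -> Ig.
  apply: GI_add; last by do 2!apply: GI_mull_odd.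
  apply: GI_sub; first exact/GI_mulr_odd/GI_mull_odd.
  exact/GI_mull_odd/GI_mulr_odd.
elim=> {f}.
- move=> f Jf; rewrite hmul_linextr.
  have := GI_odd (consequence_tins 2 false a b Jf).
  rewrite /hincl linext_comp; congr graded_ideal; apply: eq_in_linext => u _.
  by rewrite linext_mon hmul_eo.
- move=> f w Jf; apply: evenC; last exact: GI_left.
  by apply: supported_linext => u _; apply: supported_mon.
- move=> f w Jf; apply: evenC; last exact: GI_right.
  by apply: supported_linext => u _; apply: supported_mon.
- by move=> c d y z; apply: evenC; [apply: even_hrel|apply: GI_rel].
- by rewrite hmul0r; apply: GI_zero.
- by move=> f g _ If _ Ig; rewrite hmulDr; apply: GI_add.
- by move=> k f _ If; rewrite hmulZr; apply: GI_scale.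
Qed.

Lemma GI_mull f g : graded_ideal f -> graded_ideal (hmul g f).
Proof.
move=> If; rewrite -[g]linext_mon_id hmul_linextl.
apply: (subspace_linext graded_ideal_subspace) => -[c|[a b]] _.
  exact: GI_mull_odd.
exact: GI_mull_even.
Qed.

(** Writing the first element as a product of odd ones, [hrel_mull] leaves multiples of relations
    with one odd and two even arguments, which have degree 5. *)
Lemma GI_eee a b c d p q :
  graded_ideal (hrel (heven F a b) (heven F c d) (heven F p q)).
Proof.
have ooe u w f : {in msupp f, forall e, is_even e == true} ->
    hrel (hodd F u) (hodd F w) f = 0.
  by move=> ef; apply: hrel_ooe => e /ef /eqP.
have ee r s t u := even_hmul (@even_heven r s) (@even_heven t u).
have GIeeo u r s t w : graded_ideal (hrel (heven F r s) (heven F t u) (hodd F w)).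
  by rewrite hrelC; apply/GI_opp/GI_eoe.
have GIeoe := GI_eoe; have GIoee := GI_oee.
rewrite -hmul_oo hrel_mull.
rewrite !hmul_oe !hmul_eo ![hrel (hodd F _) (hodd F _) _]ooe ?hmul0l; last first.
all: try exact: even_heven.
all: try exact: ee.
rewrite !(subr0, addr0); apply: GI_add; first exact/GI_mulr_odd.
by apply: GI_mull; do 2!apply: GI_add => //; rewrite hrelC; apply: GI_opp.
Qed.

(** Eight parity types. Those of odd total degree are identities of degree 3 or 5; odd, odd, even
    holds by construction; even, odd, odd is imposed; three even arguments are [GI_eee].
    Antisymmetry in the last two arguments gives the rest. *)
Lemma GI_hrel f g h : graded_ideal (hrel f g h).
Proof.
rewrite -[f]linext_mon_id (linear_linext _ _ (hrel_lin1 _ _)).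
apply: (subspace_linext graded_ideal_subspace) => e1 _.
rewrite -[g]linext_mon_id (linear_linext _ _ (hrel_lin2 _ _)).
apply: (subspace_linext graded_ideal_subspace) => e2 _.
rewrite -[h]linext_mon_id (linear_linext _ _ (hrel_lin3 _ _)).
apply: (subspace_linext graded_ideal_subspace) => e3 _.
have GI_ooe u a b c : graded_ideal (hrel (hodd F u) (hodd F a) (heven F b c)).
  by rewrite hrel_ooe; [apply: GI_zero|move=> e /even_heven /eqP].
case: e1 e2 e3 => [u|[a b]] [w|[c d]] [z|[p q]].
- exact: GI_ooo.
- exact: GI_ooe.
- by rewrite hrelC; apply/GI_opp/GI_ooe.
- exact: GI_oee.
- exact: GI_rel.
- exact: GI_eoe.
- by rewrite hrelC; apply/GI_opp/GI_eoe.
- exact: GI_eee.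
Qed.

Lemma linextDf (K : choiceType) (V : lmodType F) (g h : K -> V) (f : {malg F[K]}) :
  linext (fun k => g k + h k) f = linext g f + linext h f.
Proof. by rewrite /linext -big_split /=; apply: eq_bigr => k _; rewrite scalerDr. Qed.

Lemma linextBf (K : choiceType) (V : lmodType F) (g h : K -> V) (f : {malg F[K]}) :
  linext (fun k => g k - h k) f = linext g f - linext h f.
Proof. by rewrite /linext -sumrB; apply: eq_bigr => k _; rewrite scalerBr. Qed.

(** On the generators of R, [hmul_relr] leaves relations, their left multiples, and their right
    multiples by odd elements, all known to lie in the ideal. *)
Lemma GI_mulr_even f p q : graded_ideal f -> graded_ideal (hmul f (heven F p q)).
Proof.
have mulee a b c d : hmul (heven F a b) (heven F c d) =
    heven F (TOp true a c d) b + heven F a (TOp true b c d) - heven F a (TOp false c d b).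
  exact: hmul_mon.
have left_tins r i b c w (f' : freeTriple F 'I_7) : consequence f' ->
    graded_ideal (linext (fun u => heven F (tins r i u b c) w) f').
  move=> Jf; have := GI_left w (consequence_tins r i b c Jf).
  rewrite linext_comp; congr graded_ideal.
  by apply: eq_in_linext => u _; rewrite linext_mon.
have right_tins r i b c w (f' : freeTriple F 'I_7) : consequence f' ->
    graded_ideal (linext (fun u => heven F w (tins r i u b c)) f').
  move=> Jf; have := GI_right w (consequence_tins r i b c Jf).
  rewrite linext_comp; congr graded_ideal.
  by apply: eq_in_linext => u _; rewrite linext_mon.
elim=> {f}.
- move=> f Jf; rewrite hmul_linextl.
  have := GI_odd (consequence_tins 0 true p q Jf).
  rewrite /hincl linext_comp; congr graded_ideal; apply: eq_in_linext => u _.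
  by rewrite linext_mon hmul_oe.
- move=> f w Jf; rewrite hmul_linextl (eq_in_linext (fun u _ => mulee u w p q)).
  rewrite linextBf linextDf; apply: GI_sub; [apply: GI_add|].
  + exact: (left_tins 0%N).
  + exact: GI_left.
  + exact: GI_left.
- move=> f w Jf; rewrite hmul_linextl (eq_in_linext (fun u _ => mulee w u p q)).
  rewrite linextBf linextDf; apply: GI_sub; [apply: GI_add|].
  + exact: GI_right.
  + exact: (right_tins 0%N).
  + exact: (right_tins 2%N).
- move=> a b y z; rewrite hmul_relr.
  have G f g h w : graded_ideal (hmul (hrel f g h) (hodd F w)).
    exact/GI_mulr_odd/GI_hrel.
  apply: GI_sub; last by apply: GI_mull; repeat first [apply: GI_hrel | apply: GI_add].
  by repeat first [apply: GI_hrel | apply: G | apply: GI_sub | apply: GI_add].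
- by rewrite hmul0l; apply: GI_zero.
- by move=> f g _ If _ Ig; rewrite hmulDl; apply: GI_add.
- by move=> k f _ If; rewrite hmulZl; apply: GI_scale.
Qed.

Lemma GI_mulr f g : graded_ideal f -> graded_ideal (hmul f g).
Proof.
move=> If; rewrite -[g]linext_mon_id hmul_linextr.
apply: (subspace_linext graded_ideal_subspace) => -[c|[a b]] _.
  exact: GI_mulr_odd.
exact: GI_mulr_even.
Qed.

(** All generators but [GI_odd] are even, so nothing more is killed in the odd part: V embeds in the
    graded algebra. *)
Lemma consequence_hpart f : graded_ideal f -> consequence (hpart f).
Proof.
have [J0 JD JZ] := consequence_subspace F.
have even0 g : {in msupp g, forall e, is_even e} -> consequence (hpart g).
  by move=> eg; rewrite hpart_even.
elim=> {f}.
- by move=> f Jf; rewrite hpart_hincl.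
- by move=> f w _; apply/even0/supported_linext => u _; apply: supported_mon.
- by move=> f w _; apply/even0/supported_linext => u _; apply: supported_mon.
- by move=> a b y z; apply/even0/even_hrel.
- by rewrite /hpart linext0.
- by move=> f g _ Jf _ Jg; rewrite /hpart linextD; exact: (JD _ _ Jf Jg).
- by move=> c f _ Jf; rewrite /hpart linextZ; exact: (JZ c _ Jf).
Qed.

End GradedIdeal.

(** * Triple monomials written with the binary product *)

Section TripleExpansion.
Context (F : fieldType) (X : choiceType).

Fixpoint tbin (Y : Type) (m : tmon Y) : bmon Y :=
  match m with
  | TVar x => BVar x
  | TOp false a b c => BMul (BMul (tbin a) (tbin b)) (tbin c)
  | TOp true a b c => BMul (tbin a) (BMul (tbin b) (tbin c))
  end.

Lemma bvars_tbin (Y : Type) (m : tmon Y) : bvars (tbin m) = tvars m.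
Proof. by elim: m => //= -[] a + b + c /= => -> -> -> //; rewrite catA. Qed.

Lemma teval_tbin (D : dendType F) (v : X -> D) (f : freeTriple F X) :
  linext (beval (@prelie F D) v) (linext (fun m => mon F (tbin m)) f) =
  teval (@prelie_triple F D) v f.
Proof.
rewrite linext_comp; apply: eq_in_linext => m _; rewrite linext_mon.
by elim: m => //= -[] a IHa b IHb c IHc; rewrite /= IHa IHb IHc.
Qed.

(** The graded product restricts to the given triple products on the odd part. *)
Lemma rho_tbin (m : tmon X) : rho F (@TVar X) (tbin m) = hodd F m.
Proof.
elim: m => //= -[] a IHa b IHb c IHc; rewrite /rho /= -!/(rho F (@TVar X) _) IHa IHb IHc.
  by rewrite hmul_oo hmul_oe.
by rewrite hmul_oo hmul_eo.
Qed.

End TripleExpansion.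

(** * Liftings and permutations of identities are identities *)

Section Converse.
Context (F : fieldType).

Lemma kerE_subspace n : subspace (@kerE F n).
Proof.
have [S0 SD SZ] := supported_subspace F (fun m : tmon 'I_n => perm_eq (tvars m) (enum 'I_n)).
split.
- by split; [apply/TTP; apply: S0|apply: expansion0].
- move=> f g [/TTP sf f0] [/TTP sg g0]; split; first by apply/TTP; apply: (SD _ _ sf sg).
  by rewrite expansionD -[RHS]addr0; exact: (f_equal2 +%R f0 g0).
- move=> c f [/TTP sf f0]; split; first by apply/TTP; apply: (SZ c _ sf).
  by rewrite expansionZ f0 scaler0.
Qed.

Lemma kerE_permute n (s : 'S_n) (f : freeTriple F 'I_n) :
  kerE f -> kerE (permute_vars s f).
Proof.
rewrite permute_varsE => -[/TTP sf f0]; split; last exact: (expansion_tsub _ f0).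
apply/TTP; apply: supported_tsub => m /sf pm; rewrite tvars_tbind.
rewrite (_ : flatten _ = map s (tvars m)); last by elim: (tvars m) => //= x l ->.
rewrite (permPl (perm_map _ pm)); apply: perm_enum_ord.
  by rewrite map_inj_uniq ?enum_uniq //; apply: perm_inj.
by rewrite size_map size_enum_ord.
Qed.

Lemma perm_lifted_vars (s : seq 'I_5) : perm_eq s (enum 'I_5) ->
  perm_eq (map (lshift 2) s ++
           [:: rshift 5 (ord0 : 'I_2); rshift 5 (ord_max : 'I_2)]) (enum 'I_(5 + 2)).
Proof.
move=> ps; apply: perm_enum_ord; last by rewrite size_cat size_map (perm_size ps) size_enum_ord.
rewrite cat_uniq map_inj_uniq ?(perm_uniq ps) ?enum_uniq; last exact: lshift_inj.
rewrite andTb; apply/andP; split=> //; apply/hasPn => y; rewrite !inE => yE.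
by apply/mapP => -[x _]; case/orP: yE => /eqP -> /eqP; rewrite eq_rlshift.
Qed.

Lemma tvars_lift_subst i k (s : seq 'I_5) : uniq s -> k \in s ->
  perm_eq (flatten [seq tvars (lift_subst i k l) | l <- s])
    (map (lshift 2) s ++ [:: rshift 5 (ord0 : 'I_2); rshift 5 (ord_max : 'I_2)]).
Proof.
move=> us /perm_to_rem ps.
rewrite (permPl (perm_flatten (perm_map _ ps))).
rewrite (permPr (perm_cat (perm_map _ ps) (perm_refl _))) /=.
rewrite {1}/lift_subst eqxx /= perm_cons -[_ :: _]/([:: _; _] ++ _) perm_catC.
rewrite (_ : flatten _ = map (lshift 2) (rem k s)) //.
have : k \notin rem k s by move: us; rewrite (perm_uniq ps) => /andP[].
elim: (rem k s) => //= l r IH; rewrite inE negb_or => /andP[neq /IH ->].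
by rewrite /lift_subst eq_sym (negPf neq).
Qed.

Lemma kerE_lifting (h : freeTriple F 'I_5) f : kerE h -> lifting h f -> kerE f.
Proof.
move=> [/TTP sh h0] /liftingP[[i [k ->]]|[q [i ->]]].
  split; last exact: (expansion_tsub _ h0).
  apply/TTP; apply: supported_tsub => m /sh pm; rewrite tvars_tbind.
  rewrite (permPl (tvars_lift_subst _ _ _)) ?(perm_uniq pm) ?enum_uniq //.
    exact: perm_lifted_vars.
  by rewrite (perm_mem pm) mem_enum.
split; last exact: (expansion_tins _ _ _ _ (expansion_tsub _ h0)).
apply/TTP; apply: (supported_linext (f := tsub _ h)) => a; rewrite /tsub => sa.
apply: supported_mon; rewrite (permPl (tvars_tins _ _ _ _ _)).
have : {in msupp (tsub (fun x => TVar (lshift 2 x)) h), forall m,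
    perm_eq (tvars m ++ [:: rshift 5 (ord0 : 'I_2); rshift 5 (ord_max : 'I_2)])
      (enum 'I_(5 + 2))}.
  apply: supported_tsub => m /sh pm; rewrite tvars_tbind.
  rewrite (_ : flatten _ = map (lshift 2) (tvars m)); first exact: perm_lifted_vars.
  by elim: (tvars m) => //= x l ->.
by apply.
Qed.

End Converse.

Theorem theorem4p7 (F : fieldType) (charF0 : [pchar F] =i pred0)
    (g : freeTriple F 'I_7) :
  kerE g <->
  Sn_span (fun h : freeTriple F 'I_7 =>
             exists2 f : freeTriple F 'I_5, kerE f & lifting f h) g.
Proof.
split=> [[/TTP sg /expansion_eq0 g0]|].
  (* The identity is read in the free magma, where [prelie_kernel] applies; evaluation in the graded
     algebra then gives back [g]. *)
  pose t := linext (fun m => mon F (tbin m)) g.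
  have It : prelie_ideal t.
    apply: prelie_kernel => [|D v]; last by rewrite teval_tbin.
    by apply: supported_linext => m /sg pm; apply: supported_mon; rewrite bvars_tbin.
  have tE : linext (rho F (@TVar 'I_7)) t = hincl g.
    rewrite linext_comp; apply: eq_in_linext => m _.
    by rewrite linext_mon rho_tbin.
  have : graded_ideal (linext (rho F (@TVar 'I_7)) t).
    apply: (beval_prelie_ideal (P := @graded_ideal F) _ _ _ _ _ _ It).
    - exact: hmul_linl.
    - exact: hmul_linr.
    - exact: graded_ideal_subspace.
    - by move=> u m; apply: GI_mulr.
    - by move=> u m; apply: GI_mull.
    - by move=> a b c; have := GI_hrel; rewrite hrel.unlock; apply.
  (* As [g] is its own component in all seven letters, the degree 7 clause of [consequence]
     concludes. *)
  rewrite tE => /consequence_hpart; rewrite hpart_hincl.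
  case/(_ _ (enum_uniq 'I_7)) => _; rewrite mpart_id //.
  by apply; rewrite size_enum_ord.
have [K0 KD KZ] := kerE_subspace F 7.
elim=> {g} [f [h kh]||f g _ kf _ kg|c f _ kf|s f _ kf].
- exact: kerE_lifting.
- exact: K0.
- exact: (KD _ _ kf kg).
- exact: (KZ c _ kf).
- exact: kerE_permute.
Qed.
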